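(* Let $\alpha=N(2a+b+\frac12)$ and $\beta=N(4a+b+\frac32)$. The Hamiltonian $H_1$ possesses the following families of spin eigenfunctions (i.e. each $\Psi$ below satisfies $H_1\Psi=E_k\Psi$) with eigenvalue $E_k=E_0+4k\omega$, where $E_0=N\omega(4a+2b+1)$: \begin{align*} \Psi^{(0)}_k&=\mu L^{\alpha-1}_k(\omega r^2)\,\Phi^{(0)},\qquad k\ge0,\\ \Psi^{(1)}_k&=\mu L^{\alpha+1}_{k-1}(\omega r^2)\big[N\Phi^{(1)}-r^2\Phi^{(0)}\big],\qquad k\ge1,\\ \Psi^{(2)}_k&=\mu L^{\alpha+3}_{k-2}(\omega r^2)\Big[N(\alpha+1)\sum_ix_i^4-\beta r^4\Big]\Phi^{(0)},\qquad k\ge2, \end{align*} where $r^2=\sum_i x_i^2$, $\Phi^{(j)}=\Lambda(x_1^{2j}|s\rangle)$ for $j=0,1$, and $|s\rangle\in\Sigma$. For each $|s\rangle\in\Sigma$ and $n=0,1,\dots$, the eigenfunctions $\Psi^{(0)}_k$, $\Psi^{(1)}_k$, $\Psi^{(2)}_k$ with $k\le n$ span the whole $H_1$-invariant space $\mu\,\mathcal H^n_{1,|s\rangle}$.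
   Context: $N\ge3$ is an integer, $a,b>1/2$ and $\omega>0$ are real; sums and products run over $1,\dots,N$ with cyclic indices ($x_0\equiv x_N$, $x_{N+1}\equiv x_1$, $S_{N,N+1}\equiv S_{N,1}$). The configuration space is $0<x_1<\dots<x_N$. Spin space: for a fixed $M\in\frac12\mathbb N$, $\Sigma$ is the complex vector space with basis $|s_1\dots s_N\rangle$, $s_i\in\{-M,\dots,M\}$; $S_{ij}$ permutes the spins $i$ and $j$. $\Lambda$ is the projector onto states totally symmetric under simultaneous permutations of coordinates and spins (average over the symmetric group). Hamiltonian, acting on $\Sigma$-valued smooth functions of $\mathbf x$: $$H_1=-\sum_i\partial_{x_i}^2+\omega^2r^2+\sum_i\frac{b(b-1)}{x_i^2}+\sum_i\frac{8a^2x_i^2}{(x_i^2-x_{i-1}^2)(x_i^2-x_{i+1}^2)}+4a\sum_i\frac{x_i^2+x_{i+1}^2}{(x_i^2-x_{i+1}^2)^2}(a-S_{i,i+1}).$$ Gauge factor: $\mu(\mathbf x)=e^{-\frac\omega2r^2}\prod_i|x_i^2-x_{i+1}^2|^a\,x_i^b$. $L^\lambda_\nu$ are the generalized Laguerre polynomials. Invariant space: put $z_i=x_i^2$, $\sigma_1=\sum_iz_i$, $\sigma_2=\sum_iz_i^2$. For $|s\rangle\in\Sigma$, $\mathcal H^n_{1,|s\rangle}$ is the span of all $f(\sigma_1,\sigma_2)\Phi^{(0)}$ and $g(\sigma_1)\Phi^{(1)}$ with $f,g$ polynomials, $\partial^2f/\partial\sigma_2^2=0$, and $f$, $g$ of total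 degree in $\mathbf z$ at most $n$ and $n-1$, respectively. A listed function may vanish identically for special $|s\rangle$; it is an eigenfunction when nonzero. *)

(* Defs.v *)
From HB Require Import structures.
From mathcomp Require Import all_boot all_order all_algebra all_fingroup.
From mathcomp Require Import complex.
From mathcomp Require Import all_classical all_reals all_analysis.
(* mpoly's notations clash with those of MathComp-Analysis *)
From mathcomp Require Import -(notations) mpoly.

Set Implicit Arguments.
Unset Strict Implicit.
Unset Printing Implicit Defensive.

Import Order.TTheory GRing.Theory Num.Theory.
Import numFieldNormedType.Exports.

Local Open Scope classical_set_scope.
Local Open Scope ring_scope.
Local Open Scope complex_scope.

(* Site [i] of the text is the ordinal [i - 1]; [ordS] and [ord_pred] are the
   cyclic successor and predecessor. *)
Definition site1 (N : nat) (hN : (2 < N)%N) : 'I_N :=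
  Ordinal (leq_trans (isT : (0 < 3)%N) hN).

(* Spin M = m / 2: the ordinal [q < 2 M + 1] stands for the spin value q - M. *)
Definition spins (N m : nat) := {ffun 'I_N -> 'I_m.+1}.

(* A state is given by its coordinates in the basis |s_1 ... s_N>; [R[i]^o] is
   the complex field as a vector space over itself. *)
Definition Sigma (R : realType) (N m : nat) := {ffun spins N m -> R[i]^o}.

Definition wave (R : realType) (N m : nat) := 'rV[R]_N -> Sigma R N m.

Section Model.
Variables (R : realType) (N m : nat).
Local Notation C := R[i].
Local Notation point := 'rV[R]_N.
Local Notation St := (Sigma R N m).
Local Notation W := (wave R N m).

Definition config : set point :=
  [set x : point | (forall i, 0 < x 0 i) /\
           (forall i j : 'I_N, (i < j)%N -> x 0 i < x 0 j)].

Definition r2 (x : point) : R := \sum_i x 0 i ^+ 2.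

(* Linear extension of the map moving the spin at site i to site (p i). *)
Definition spin_perm (p : 'S_N) (v : St) : St :=
  [ffun s : spins N m => v [ffun i => s (p i)]].

Definition S_ (i j : 'I_N) : St -> St := spin_perm (tperm i j).

(* [col_perm p x] has coordinates x_(p i), so composing with it sends the
   coordinate function x_i to x_(p i), in agreement with [spin_perm]. *)
Definition Lambda (F : W) : W := fun x =>
  (N`!%:R : C)^-1 *: \sum_(p : 'S_N) spin_perm p (F (col_perm p x)).

Definition pd (i : 'I_N) (f : point -> R) : point -> R :=
  fun x => 'D_(delta_mx 0 i) f x.

Definition rePart (F : W) (s : spins N m) : point -> R := fun x => complex.Re (F x s).
Definition imPart (F : W) (s : spins N m) : point -> R := fun x => complex.Im (F x s).

Definition pdW (i : 'I_N) (F : W) : W := fun x =>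
  [ffun s => pd i (rePart F s) x +i* pd i (imPart F s) x].

Fixpoint Ck (k : nat) (f : point -> R) : Prop :=
  (forall x, config x -> {for x, continuous f}) /\
  if k is k'.+1 then
    forall i, (forall x, config x -> derivable f x (delta_mx 0 i)) /\
              Ck k' (pd i f)
  else True.

(* Functions are total on R^N, but only their values on [config] matter; smooth
   means C^oo there. *)
Definition smooth (F : W) : Prop :=
  forall s k, Ck k (rePart F s) /\ Ck k (imPart F s).

Definition eigenfunction (H : W -> W) (E : R) (F : W) : Prop :=
  smooth F /\ forall x, config x -> H F x = E%:C *: F x.

(* Complex linear span, as functions on [config]. *)
Definition cspan (G : set W) : set W := [set F |
  exists (d : nat) (c : 'I_d -> C) (B : 'I_d -> W),
    (forall i, G (B i)) /\
    (forall x, config x -> F x = \sum_(i < d) c i *: B i x)].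

Definition invariant_under (H : W -> W) (V : set W) : Prop :=
  forall F, V F -> V (H F).

Definition H1 (a b w : R) (F : W) : W := fun x =>
  - (\sum_i pdW i (pdW i F) x)
  + (w ^+ 2 * r2 x)%:C *: F x
  + (\sum_i b * (b - 1) / x 0 i ^+ 2)%:C *: F x
  + (\sum_i 8 * a ^+ 2 * x 0 i ^+ 2 /
       ((x 0 i ^+ 2 - x 0 (ord_pred i) ^+ 2)
        * (x 0 i ^+ 2 - x 0 (ordS i) ^+ 2)))%:C *: F x
  + (4 * a)%:C *: \sum_i
      ((x 0 i ^+ 2 + x 0 (ordS i) ^+ 2)
        / (x 0 i ^+ 2 - x 0 (ordS i) ^+ 2) ^+ 2)%:C
      *: (a%:C *: F x - S_ i (ordS i) (F x)).

Definition mu (a b w : R) (x : point) : R :=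
  expR (- (w / 2) * r2 x) *
  \prod_i (`| x 0 i ^+ 2 - x 0 (ordS i) ^+ 2 | `^ a * x 0 i `^ b).

Definition muW (a b w : R) (F : W) : W := fun x => (mu a b w x)%:C *: F x.

(* \sum_(j <= k) (-1)^j 'C(k + nu, k - j) t^j / j!, where
   'C(k + nu, k - j) = (nu + j + 1) ... (nu + k) / (k - j)!. *)
Definition laguerre (nu : R) (k : nat) (t : R) : R :=
  \sum_(j < k.+1) (-1) ^+ j
    * ((\prod_(i < k - j) (nu + j%:R + i.+1%:R)) / (k - j)`!%:R)
    * (t ^+ j / j`!%:R).

Definition alpha (a b : R) : R := N%:R * (2 * a + b + 1 / 2).
Definition beta (a b : R) : R := N%:R * (4 * a + b + 3 / 2).
Definition E0 (a b w : R) : R := N%:R * w * (4 * a + 2 * b + 1).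
Definition energy (a b w : R) (k : nat) : R := E0 a b w + 4 * k%:R * w.

Section States.
Variables (i1 : 'I_N) (s : St).

Definition Phi (j : nat) : W := Lambda (fun x => (x 0 i1 ^+ (2 * j))%:C *: s).

Definition Psi0 (a b w : R) (k : nat) : W :=
  muW a b w (fun x => (laguerre (alpha a b - 1) k (w * r2 x))%:C *: Phi 0 x).

(* for k >= 1 *)
Definition Psi1 (a b w : R) (k : nat) : W :=
  muW a b w (fun x => (laguerre (alpha a b + 1) (k - 1) (w * r2 x))%:C *:
    ((N%:R : C) *: Phi 1 x - (r2 x)%:C *: Phi 0 x)).

(* for k >= 2 *)
Definition Psi2 (a b w : R) (k : nat) : W :=
  muW a b w (fun x => (laguerre (alpha a b + 3) (k - 2) (w * r2 x))%:C *:
    ((N%:R * (alpha a b + 1) * (\sum_i x 0 i ^+ 4)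
      - beta a b * (r2 x) ^+ 2)%:C *: Phi 0 x)).

Definition eigenfamily (a b w : R) (n : nat) : set W := [set G |
  exists2 k : nat, (k <= n)%N &
    [\/ G = Psi0 a b w k,
        (1 <= k)%N /\ G = Psi1 a b w k |
        (2 <= k)%N /\ G = Psi2 a b w k]].

(* sigma_k as a polynomial in z_1, ..., z_N *)
Definition sigma (k : nat) : mpoly N C := \sum_(i < N) mpolyX C (mnm1 i) ^+ k.

(* f(sigma_1, sigma_2) and g(sigma_1) as polynomials in z *)
Definition subst2 (f : mpoly 2 C) : mpoly N C :=
  comp_mpoly [tuple sigma 1; sigma 2] f.
Definition subst1 (g : {poly C}) : mpoly N C :=
  (map_poly (@mpolyC N C) g).[sigma 1].

(* value of a polynomial in z at z_i = x_i^2 *)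
Definition at_squares (p : mpoly N C) (x : point) : C :=
  meval (fun i => (x 0 i ^+ 2)%:C) p.

(* [msize p] is 1 + the total degree of p, and 0 for p = 0; the variable of
   index 1 of f stands for sigma_2. *)
Definition Hspace (n : nat) : set W := cspan [set G |
  (exists f : mpoly 2 C,
     [/\ mderiv (1 : 'I_2) (mderiv (1 : 'I_2) f) = 0,
         (msize (subst2 f) <= n.+1)%N &
         G = fun x => at_squares (subst2 f) x *: Phi 0 x]) \/
  (exists g : {poly C},
     (msize (subst1 g) <= n)%N /\
     G = fun x => at_squares (subst1 g) x *: Phi 1 x)].

Definition muHspace (a b w : R) (n : nat) : set W := [set G |
  exists2 F, Hspace n F & forall x, config x -> G x = muW a b w F x].

End States.
End Model.

(* Main.v *)
(** Put z_i = x_i^2.  Conjugating H_1 by the gauge factor turns it into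
    E_0 + 4 w (Euler operator in z) - T, where T, a Laplacian with drift plus
    exchange terms, lowers the degree in z by one.  If chi is homogeneous of
    degree d in z and T chi = 0, then the eigenvalue equation for
    p(w sigma_1) chi is the Laguerre equation of parameter alpha - 1 + 2 d.
    The three families come from chi = Phi^(0), N Phi^(1) - sigma_1 Phi^(0) and
    (N (alpha + 1) sigma_2 - beta sigma_1^2) Phi^(0), of degree 0, 1 and 2.

    Since L_0, ..., L_k span the polynomials of degree at most k, the span
    reduces to a degree count: a bound on the degree in z of
    p(sigma_1) + q(sigma_1) sigma_2 bounds the degrees of p and q separately.
    Invariance of the span follows from the eigenvalue equations. *)

Require Import Defs.
From mathcomp Require Import all_boot all_order all_algebra all_fingroup.
From mathcomp Require Import complex ring lra.
From mathcomp Require Import all_classical all_reals all_analysis.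
From mathcomp Require Import -(notations) mpoly.

Set Implicit Arguments.
Unset Strict Implicit.
Unset Printing Implicit Defensive.

Import Order.TTheory GRing.Theory Num.Theory.
Import numFieldNormedType.Exports.

Local Open Scope classical_set_scope.
Local Open Scope ring_scope.
Local Open Scope complex_scope.

(** * Differentiation along the coordinate axes *)

(** H_1 exchanges only neighbouring spins, with coefficients singular at z_i = z_{i+1}, so the point
    is why T maps these states to polynomial ones. Symmetry under simultaneous permutations trades a
    spin exchange for a coordinate exchange: Phi^(0) is constant in x and fixed by every S_{i,i+1},
    and in Phi^(1) = sum_l z_l c_l the exchange permutes the coefficients c_l. The singular terms
    then cancel link by link, and what remains sums around the cycle to a constant multiple of sum_l
    c_l = Phi^(0). Subtracting sigma_1 Phi^(0) from N Phi^(1) makes the coefficients sum to zero. On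
    multiples of Phi^(0) the exchange terms vanish, with T sigma_2 = (8 beta / N) sigma_1 and T
    sigma_1^2 = 8 (alpha + 1) sigma_1; this is the origin of the coefficients N (alpha + 1) and
    beta.

    States are complex while derivatives are taken of real functions. As H_1 has real coefficients,
    the equations are proved for real and imaginary parts separately. *)

Section DirectionalDerivative.
Variables (R : realType) (V : normedModType R).
Implicit Types (f g : V -> R) (x v : V).

(** Restriction to the line through x along v reduces directional derivatives to the calculus of one
    real variable, in particular to its chain rule. *)
Lemma is_derive_line f x v (df : R) :
  is_derive x v f df <-> is_derive (0 : R) 1 (fun h : R => f (h *: v + x)) df.
Proof.
have E : 'D_v f x = 'D_1 (fun h : R => f (h *: v + x)) 0.
  rewrite /derive; set g1 := fun h => h^-1 *: _; set g2 := fun h => h^-1 *: _.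
  suff -> : g1 = g2 by []; rewrite funeqE /g1 /g2 => h /=.
  by rewrite addr0 scale0r add0r [_%:A]mulr1.
have D : derivable f x v <-> derivable (fun h : R => f (h *: v + x)) 0 1.
  exact: derivable1P.
by split=> -[/D fx fv]; apply: DeriveDef; rewrite -?fv ?E.
Qed.

Lemma is_derive_comp1 (h : R -> R) f x v (dh df : R) :
  is_derive (f x) 1 h dh -> is_derive x v f df ->
  is_derive x v (h \o f) (dh * df).
Proof.
move=> hd /is_derive_line fd; apply/is_derive_line.
apply: (@is_derive1_comp R h (fun t => f (t *: v + x)) 0 dh df _ fd).
by rewrite scale0r add0r.
Qed.

End DirectionalDerivative.

Section Smoothness.
Variables (R : realType) (N : nat).
Local Notation point := 'rV[R]_N.
Local Notation conf := (@config R N).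
Local Notation ax i := (delta_mx 0 i : point).
Implicit Types (f g : point -> R) (x : point).

Lemma config_gt0 x i : conf x -> 0 < x 0 i.
Proof. by case=> + _; apply. Qed.

Lemma config_sqr_neq x i j : conf x -> i != j -> x 0 i ^+ 2 != x 0 j ^+ 2.
Proof.
move=> [x0 xlt] ij; rewrite eqrXn2// ?ltW//.
have [/xlt/lt_eqF->//|/xlt/gt_eqF->//|/val_inj eij] := ltngtP i j.
by rewrite eij eqxx in ij.
Qed.

(** The chamber is cut out by finitely many strict inequalities between continuous functions, hence
    open; equality on it therefore passes to derivatives and continuity. *)
Lemma near_config x : conf x -> \forall y \near x, conf y.
Proof.
move=> [x0 xlt]; have c i := @coord_continuous R 1 N 0 i x.
have F : Filter (nbhs x) by exact: nbhs_filter.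
have H1 : \forall y \near x, forall i, 0 < (y : point) 0 i.
  apply: (@filter_forall _ _ (fun i (y : point) => 0 < y 0 i) _ F) => i.
  exact: (@cvgr_gt R _ _ F (fun y : point => y 0 i) _ (c i) _ (x0 i)).
have H2 (i j : 'I_N) : (i < j)%N -> \forall y \near x, (y : point) 0 i < y 0 j.
  move=> ij; have cji : (fun y : point => y 0 j - y 0 i) @ x --> x 0 j - x 0 i.
    by apply: cvgB; exact: c.
  have := @cvgr_gt R _ _ F _ _ cji 0; rewrite subr_gt0 => /(_ (xlt _ _ ij)).
  by apply: filterS => y; rewrite subr_gt0.
have H3 := filter_forall F (fun i => filter_forall F (fun j => filter_imply F (@H2 i j))).
by apply: filterS2 H1 H3 => y.
Qed.

Definition eqc f g := forall x, conf x -> f x = g x.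

Lemma eqc_near f g x : eqc f g -> conf x -> \forall y \near x, f y = g y.
Proof. by move=> fg cx; apply: filterS (near_config cx) => y; exact: fg. Qed.

(** A relation carrying an explicit derivative, asked on the open chamber only: the rules below
    compose, and [has_pd_eqc] brings the computed derivative to the desired form. *)
Definition has_pd (i : 'I_N) f df := forall x, conf x -> is_derive x (ax i) f (df x).

Lemma has_pd_eqc i f g df dg :
  eqc f g -> eqc df dg -> has_pd i f df -> has_pd i g dg.
Proof.
move=> fg dfg fd x cx; rewrite -dfg//.
by apply: near_eq_is_derive (fd x cx); exact: eqc_near.
Qed.

Lemma pd_has_pd i f df : has_pd i f df -> eqc (pd i f) df.
Proof. by move=> fd x /fd[]. Qed.

Lemma pd_eqc i f g : eqc f g -> eqc (pd i f) (pd i g).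
Proof. by move=> fg x cx; apply: near_eq_derive; exact: eqc_near. Qed.

Lemma pd_pd i f df ddf :
  has_pd i f df -> has_pd i df ddf -> eqc (pd i (pd i f)) ddf.
Proof.
move=> /pd_has_pd fd dfd x cx; rewrite (pd_eqc i fd)//; exact: pd_has_pd.
Qed.

Lemma has_pd_cst i c : has_pd i (fun=> c) (fun=> 0).
Proof. by move=> x _; exact: is_derive_cst. Qed.

Lemma has_pd_coord i j : has_pd i (fun x => x 0 j) (fun=> (i == j)%:R).
Proof.
move=> x _; apply/is_derive_line.
have -> : (fun h : R => (h *: ax i + x) 0 j) = (fun h => h * (i == j)%:R + x 0 j).
  by apply/funext => h; rewrite !mxE eqxx eq_sym.
have H : is_derive (0 : R) 1 ((i == j)%:R \*: id + cst (x 0 j)) ((i == j)%:R *: 1 + 0).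
  exact: is_deriveD.
rewrite [(i == j)%:R *: 1]mulr1 addr0 in H.
rewrite (_ : (fun h : R => _) = (i == j)%:R \*: id + cst (x 0 j))//.
by apply/funext => h /=; rewrite mulrC.
Qed.

Lemma has_pdD i f g df dg : has_pd i f df -> has_pd i g dg ->
  has_pd i (fun x => f x + g x) (fun x => df x + dg x).
Proof. by move=> fd gd x cx; exact: (is_deriveD (fd x cx) (gd x cx)). Qed.

Lemma has_pdM i f g df dg : has_pd i f df -> has_pd i g dg ->
  has_pd i (fun x => f x * g x) (fun x => f x * dg x + g x * df x).
Proof. by move=> fd gd x cx; exact: (is_deriveM (fd x cx) (gd x cx)). Qed.

Lemma has_pdZ i c f df : has_pd i f df ->
  has_pd i (fun x => c * f x) (fun x => c * df x).
Proof.
move=> fd; apply: has_pd_eqc (has_pdM (has_pd_cst i c) fd) => // x _.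
by rewrite mulr0 addr0.
Qed.

Lemma has_pdX2 i f df : has_pd i f df ->
  has_pd i (fun x => f x ^+ 2) (fun x => 2 * f x * df x).
Proof.
by move=> fd; apply: has_pd_eqc (has_pdM fd fd) => // x _; ring.
Qed.

Lemma has_pd_sum (I : Type) (r : seq I) i (f df : I -> point -> R) :
  (forall j, has_pd i (f j) (df j)) ->
  has_pd i (fun x => \sum_(j <- r) f j x) (fun x => \sum_(j <- r) df j x).
Proof.
move=> fd; elim: r => [|j r IH].
  by apply: has_pd_eqc (has_pd_cst i 0) => x _; rewrite big_nil.
by apply: has_pd_eqc (has_pdD (fd j) IH) => x _; rewrite big_cons.
Qed.

Lemma has_pdV i f df : (forall x, conf x -> f x != 0) -> has_pd i f df ->
  has_pd i (fun x => (f x)^-1) (fun x => - (f x)^-1 ^+ 2 * df x).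
Proof.
move=> f0 fd x cx; have [fx fxd] := fd x cx; split.
  by apply: derivableV => //; exact: f0.
by rewrite deriveV ?f0// fxd exprVn.
Qed.

Lemma has_pd_comp i (h : R -> R) (dh : R -> R) f df :
  (forall x, conf x -> is_derive (f x) 1 h (dh (f x))) -> has_pd i f df ->
  has_pd i (fun x => h (f x)) (fun x => dh (f x) * df x).
Proof. by move=> hd fd x cx; apply: is_derive_comp1; [exact: hd|exact: fd]. Qed.

Lemma Ck_eqc k f g : eqc f g -> Ck k f -> Ck k g.
Proof.
elim: k f g => [|k IH] f g fg [fc fk]; split.
- move=> x cx; rewrite /prop_for /continuous_at -fg//.
  apply: cvg_trans (fc x cx); apply: (@near_eq_cvg _ _ _ (nbhs_filter x)).
  exact: eqc_near fg cx.
- by [].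
- move=> x cx; rewrite /prop_for /continuous_at -fg//.
  apply: cvg_trans (fc x cx); apply: (@near_eq_cvg _ _ _ (nbhs_filter x)).
  exact: eqc_near fg cx.
- move=> i; have [fd fk'] := fk i; split; last exact: IH (pd_eqc i fg) fk'.
  by move=> x cx; apply: near_eq_derivable (fd x cx); exact: eqc_near.
Qed.

Lemma Ck_cont k f x : Ck k f -> conf x -> {for x, continuous f}.
Proof. by case: k => [|k] [fc _]; exact: fc. Qed.

Lemma CkW k f : Ck k.+1 f -> Ck k f.
Proof.
elim: k f => [|k IH] f [fc fk]; split=> // i.
by have [fd /IH] := fk i.
Qed.

Lemma Ck_pd k f i : Ck k.+1 f -> has_pd i f (pd i f).
Proof. by move=> [_ /(_ i)[fd _]] x cx; exact/derivableP/fd. Qed.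

(** Derivatives along the axes do not give continuity, which is therefore a separate premise. The
    explicit [df] replaces [pd i f], with which it agrees on the chamber. *)
Lemma CkSP k f df : (forall x, conf x -> {for x, continuous f}) ->
  (forall i, has_pd i f (df i)) -> (forall i, Ck k (df i)) -> Ck k.+1 f.
Proof.
move=> fc fd dfk; split=> // i; split.
  by move=> x cx; have [] := fd i x cx.
by apply: Ck_eqc (dfk i) => x cx; rewrite (pd_has_pd (fd i)).
Qed.

Lemma Ck_cst k (c : R) : Ck k (fun _ : point => c).
Proof.
elim: k c => [|k IH] c; first by split=> // x _; exact: cst_continuous.
apply: (CkSP (df := fun=> fun=> 0)); last by move=> i; exact: IH.
  by move=> x _; exact: cst_continuous.
by move=> i; exact: has_pd_cst.
Qed.

Lemma Ck_coord k j : Ck k (fun x : point => x 0 j).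
Proof.
have c x : conf x -> {for x, continuous (fun x : point => x 0 j)}.
  by move=> _; exact: coord_continuous.
case: k => [|k] //; apply: (CkSP c (fun i => has_pd_coord i j)) => i.
exact: Ck_cst.
Qed.

Lemma CkD k f g : Ck k f -> Ck k g -> Ck k (fun x => f x + g x).
Proof.
elim: k f g => [|k IH] f g fk gk.
  by split=> // x cx; apply: (@continuousD _ _ _ f g); [exact: Ck_cont fk cx|exact: Ck_cont gk cx].
apply: (CkSP (df := fun i x => pd i f x + pd i g x)) => [x cx|i|i].
- by apply: (@continuousD _ _ _ f g); [exact: Ck_cont fk cx|exact: Ck_cont gk cx].
- by apply: has_pdD; [exact: Ck_pd fk|exact: Ck_pd gk].
- by apply: IH; [case: fk|case: gk] => _ /(_ i)[].
Qed.

Lemma CkM k f g : Ck k f -> Ck k g -> Ck k (fun x => f x * g x).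
Proof.
elim: k f g => [|k IH] f g fk gk.
  by split=> // x cx; apply: (@continuousM _ _ f g); [exact: Ck_cont fk cx|exact: Ck_cont gk cx].
apply: (CkSP (df := fun i x => f x * pd i g x + g x * pd i f x)) => [x cx|i|i].
- by apply: (@continuousM _ _ f g); [exact: Ck_cont fk cx|exact: Ck_cont gk cx].
- by apply: has_pdM; [exact: Ck_pd fk|exact: Ck_pd gk].
- apply: CkD; apply: IH; try exact: CkW.
  + by case: gk => _ /(_ i)[].
  + by case: fk => _ /(_ i)[].
Qed.

Lemma Ck_sum k (I : Type) (r : seq I) (f : I -> point -> R) :
  (forall j, Ck k (f j)) -> Ck k (fun x => \sum_(j <- r) f j x).
Proof.
move=> fk; elim: r => [|j r IH].
  by apply: Ck_eqc (Ck_cst k 0) => x _; rewrite big_nil.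
by apply: Ck_eqc (CkD (fk j) IH) => x _; rewrite big_cons.
Qed.

Lemma CkX k f n : Ck k f -> Ck k (fun x => f x ^+ n).
Proof.
move=> fk; elim: n => [|n IH]; first exact: Ck_cst.
by apply: Ck_eqc (CkM fk IH) => x _; rewrite exprS.
Qed.

Lemma CkV k f : (forall x, conf x -> f x != 0) -> Ck k f ->
  Ck k (fun x => (f x)^-1).
Proof.
move=> f0; have c l x : Ck l f -> conf x -> {for x, continuous (fun x => (f x)^-1)}.
  by move=> fl cx; apply: (@continuousV _ _ f); [exact: f0|exact: Ck_cont fl cx].
elim: k => [|k IH] fk; first by split=> // x cx; exact: c fk cx.
apply: (CkSP (df := fun i x => - (f x)^-1 ^+ 2 * pd i f x)) => [x cx|i|i].
- exact: c fk cx.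
- by apply: has_pdV => //; exact: Ck_pd fk.
- apply: CkM; last by case: fk => _ /(_ i)[].
  apply: Ck_eqc (CkM (Ck_cst k (-1)) (CkX 2 (IH (CkW fk)))) => x _.
  by rewrite mulN1r.
Qed.

Lemma Ck_expR k f : Ck k f -> Ck k (fun x => expR (f x)).
Proof.
have c l x : Ck l f -> conf x -> {for x, continuous (fun x => expR (f x))}.
  move=> fl cx; apply: (@continuous_comp _ _ _ f expR).
    exact: Ck_cont fl cx.
  exact: continuous_expR.
elim: k => [|k IH] fk; first by split=> // x cx; exact: c fk cx.
apply: (CkSP (df := fun i x => expR (f x) * pd i f x)) => [x cx|i|i].
- exact: c fk cx.
- by apply: has_pd_comp (Ck_pd i fk) => x _; exact: is_derive_expR.
- by apply: CkM; [exact/IH/CkW|case: fk => _ /(_ i)[]].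
Qed.

Lemma Ck_ln k f : (forall x, conf x -> 0 < f x) -> Ck k f ->
  Ck k (fun x => ln (f x)).
Proof.
move=> f0; have c l x : Ck l f -> conf x -> {for x, continuous (fun x => ln (f x))}.
  move=> fl cx; apply: (@continuous_comp _ R R f (@ln R)).
    exact: Ck_cont fl cx.
  by apply: continuous_ln; exact: f0.
case: k => [|k] fk; first by split=> // x cx; exact: c fk cx.
apply: (CkSP (df := fun i x => (f x)^-1 * pd i f x)) => [x cx|i|i].
- exact: c fk cx.
- by apply: (has_pd_comp (dh := fun y => y^-1)) (Ck_pd i fk) => x cx; exact/is_derive1_ln/f0.
- apply: CkM; last by case: fk => _ /(_ i)[].
  by apply: CkV; [move=> x /f0/gt_eqF->|exact: CkW].
Qed.

Lemma Ck_horner k (p : {poly R}) f : Ck k f -> Ck k (fun x => p.[f x]).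
Proof.
move=> fk; apply: (Ck_eqc (f := fun x => \sum_(j <- iota 0 (size p)) p`_j * f x ^+ j)).
  move=> x _; rewrite horner_coef -(big_mkord xpredT (fun j => p`_j * f x ^+ j)).
  by rewrite /index_iota subn0.
by apply: Ck_sum => j; apply: CkM; [exact: Ck_cst|exact: CkX].
Qed.

Lemma has_pd_horner (p : {poly R}) i f df : has_pd i f df ->
  has_pd i (fun x => p.[f x]) (fun x => p^`().[f x] * df x).
Proof.
by apply: (has_pd_comp (h := horner p) (dh := horner p^`())) => x _; exact: is_derive_poly.
Qed.

End Smoothness.

(** * The gauge factor and the gauged Hamiltonian *)

Section Cyclic.
Variables (N : nat) (hN : (1 < N)%N).

Lemma ordS_neq (i : 'I_N) : ordS i != i.
Proof.
rewrite -val_eqE /=; have := ltn_ord i; rewrite leq_eqVlt => /orP[/eqP e|lt].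
  by rewrite e modnn; apply/eqP => i0; move: hN; rewrite -{1}e -i0.
by rewrite modn_small// gtn_eqF.
Qed.

Lemma ord_pred_neq (i : 'I_N) : ord_pred i != i.
Proof. by rewrite -{2}(ord_predK i) eq_sym ordS_neq. Qed.

Lemma sum_ord_pred (V : nmodType) (F : 'I_N -> V) :
  \sum_i F (ord_pred i) = \sum_i F i.
Proof.
rewrite [RHS](reindex (@ord_pred N))//.
by exists (@ordS N) => i _; [exact: ord_predK|exact: ordSK].
Qed.

Lemma sum_delta (R : pzRingType) (F : 'I_N -> R) i :
  \sum_j (i == j)%:R * F j = F i.
Proof.
rewrite (bigD1 i)//= eqxx mul1r big1 ?addr0// => j.
by rewrite eq_sym => /negPf->; rewrite mul0r.
Qed.

Lemma sum_delta_ordS (R : pzRingType) (F : 'I_N -> R) i :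
  \sum_j (i == ordS j)%:R * F j = F (ord_pred i).
Proof.
rewrite -(sum_delta F); apply: eq_bigr => j _.
by rewrite -(inj_eq (can_inj (@ord_predK N))) ordSK.
Qed.

End Cyclic.

Section Gauge.
Variables (R : realType) (N : nat) (hN : (1 < N)%N) (a b w : R).
Local Notation point := 'rV[R]_N.
Local Notation conf := (@config R N).
Implicit Types (x : point) (i j : 'I_N).

Definition link j x : R := (x 0 j ^+ 2 - x 0 (ordS j) ^+ 2)^-1.

Lemma link_den_neq0 j x : conf x -> x 0 j ^+ 2 - x 0 (ordS j) ^+ 2 != 0.
Proof.
by move=> cx; rewrite subr_eq0 config_sqr_neq// eq_sym ordS_neq.
Qed.

Lemma has_pd_sqr_coord i j :
  has_pd i (fun x : point => x 0 j ^+ 2) (fun x => 2 * x 0 j * (i == j)%:R).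
Proof. by apply: has_pdX2; exact: has_pd_coord. Qed.

Lemma has_pd_r2 i : has_pd i (@r2 R N) (fun x => 2 * x 0 i).
Proof.
have := has_pd_sum (index_enum 'I_N) (fun j => has_pd_sqr_coord i j).
apply: has_pd_eqc => x _ //; rewrite -(sum_delta (fun j => 2 * x 0 j)).
by apply: eq_bigr => j _; rewrite mulrC.
Qed.

Lemma Ck_r2 k : Ck k (@r2 R N).
Proof. by apply: Ck_sum => j; apply: CkX; exact: Ck_coord. Qed.

Lemma has_pd_link_den i j :
  has_pd i (fun x : point => x 0 j ^+ 2 - x 0 (ordS j) ^+ 2)
    (fun x => 2 * x 0 i * ((i == j)%:R - (i == ordS j)%:R)).
Proof.
apply: has_pd_eqc (has_pdD (has_pd_sqr_coord i j)
  (has_pdZ (-1) (has_pd_sqr_coord i (ordS j)))) => x _.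
  by rewrite mulN1r.
have delta l : (i == l)%:R * x 0 l = (i == l)%:R * x 0 i.
  by case: eqVneq => [->|_]; rewrite ?mul0r.
rewrite mulN1r mulrBr -!mulrA [x 0 j * _]mulrC [x 0 (ordS j) * _]mulrC !delta.
by rewrite ![x 0 i * _]mulrC.
Qed.

Lemma has_pd_link i j :
  has_pd i (link j)
    (fun x => - link j x ^+ 2 * (2 * x 0 i * ((i == j)%:R - (i == ordS j)%:R))).
Proof.
by apply: has_pdV (has_pd_link_den i j) => x; exact: link_den_neq0.
Qed.

(** Half the logarithm of the square replaces the logarithm of the absolute value: the difference
    z_j - z_{j+1} is negative along the chain but positive at the closing link, and this form needs
    no case distinction. *)
Definition logmu x : R :=
  - (w / 2) * r2 x +
  \sum_j (a / 2 * ln ((x 0 j ^+ 2 - x 0 (ordS j) ^+ 2) ^+ 2) + b * ln (x 0 j)).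

Lemma mu_expR : eqc (mu a b w) (fun x => expR (logmu x)).
Proof.
move=> x cx; rewrite /mu expRD expR_sum; congr (_ * _); apply: eq_bigr => j _.
rewrite expRD /powR normr_eq0 (negPf (link_den_neq0 j cx)).
rewrite gt_eqF ?config_gt0//; congr (expR _ * _).
rewrite -[_ ^+ 2 in RHS]real_normK ?num_real// lnXn ?normr_gt0 ?link_den_neq0//.
by field.
Qed.

Definition dlogmu i x : R :=
  - w * x 0 i + 2 * a * x 0 i * (link i x - link (ord_pred i) x) + b / x 0 i.

Lemma has_pd_logmu i : has_pd i logmu (dlogmu i).
Proof.
have term j : has_pd i
    (fun x : point => a / 2 * ln ((x 0 j ^+ 2 - x 0 (ordS j) ^+ 2) ^+ 2) + b * ln (x 0 j))
    (fun x => 2 * a * x 0 i * ((i == j)%:R * link j x - (i == ordS j)%:R * link j x)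
       + (i == j)%:R * (b / x 0 j)).
  have d2 x : conf x -> (x 0 j ^+ 2 - x 0 (ordS j) ^+ 2) ^+ 2 > 0.
    by move=> cx; rewrite exprn_even_gt0//= link_den_neq0.
  have ln1 := has_pd_comp (h := @ln R) (dh := fun y => y^-1)
    (fun x cx => is_derive1_ln (d2 x cx)) (has_pdX2 (has_pd_link_den i j)).
  have ln2 := has_pd_comp (h := @ln R) (dh := fun y => y^-1)
    (fun x cx => is_derive1_ln (config_gt0 j cx)) (has_pd_coord i j).
  apply: has_pd_eqc (has_pdD (has_pdZ (a / 2) ln1) (has_pdZ b ln2)) => // x cx.
  have := link_den_neq0 j cx; rewrite /link.
  move: (_ - _ : R) => d d0; have x0 := lt0r_neq0 (config_gt0 j cx).
  by field; rewrite d0 x0.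
apply: has_pd_eqc (has_pdD (has_pdZ (- (w / 2)) (has_pd_r2 i))
  (has_pd_sum (index_enum 'I_N) term)) => // x _.
(* Only the links [i] and [ord_pred i] involve the coordinate i. *)
rewrite big_split/= -mulr_sumr sumrB sum_delta.
rewrite (sum_delta_ordS (link^~ x)) (sum_delta (fun j => b / x 0 j)) addrA.
by congr (_ + _ + _); field.
Qed.

Lemma Ck_mu k : Ck k (mu a b w : point -> R).
Proof.
apply: (@Ck_eqc _ _ _ (fun x => expR (logmu x))).
  by move=> x cx; rewrite mu_expR.
apply/Ck_expR/CkD; first by apply: CkM (Ck_r2 k); exact: Ck_cst.
have cc j : Ck k (fun x : point => x 0 j ^+ 2) by apply: CkX; exact: Ck_coord.
apply: Ck_sum => j; apply: CkD; apply: CkM; try exact: Ck_cst.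
  apply: Ck_ln => [x cx|]; first by rewrite exprn_even_gt0//= link_den_neq0.
  apply: CkX; apply: CkD => //.
  by apply: Ck_eqc (CkM (Ck_cst N k (-1)) (cc (ordS j))) => x _; rewrite mulN1r.
by apply: Ck_ln; [move=> x cx; exact: config_gt0|exact: Ck_coord].
Qed.

Lemma has_pd_mu i : has_pd i (mu a b w) (fun x => mu a b w x * dlogmu i x).
Proof.
have H := has_pd_comp (h := @expR R) (dh := @expR R)
  (fun x _ => is_derive_expR (logmu x)) (has_pd_logmu i).
by apply: has_pd_eqc H => x cx; rewrite mu_expR.
Qed.

Definition ddlogmu i x : R :=
  - w + 2 * a * (link i x - link (ord_pred i) x)
  - 4 * a * x 0 i ^+ 2 * (link i x ^+ 2 + link (ord_pred i) x ^+ 2)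
  - b / x 0 i ^+ 2.

Lemma has_pd_dlogmu i : has_pd i (dlogmu i) (ddlogmu i).
Proof.
have c := @has_pd_coord R N i i.
have x0 x : conf x -> x 0 i != 0 by move=> cx; rewrite gt_eqF ?config_gt0.
have l := has_pdD (has_pd_link i i) (has_pdZ (-1) (has_pd_link i (ord_pred i))).
have H := has_pdD (has_pdD (has_pdZ (- w) c)
  (has_pdM (has_pdZ (2 * a) c) l)) (has_pdZ b (has_pdV x0 c)).
apply: has_pd_eqc H => x cx.
  by rewrite mulN1r.
(* A site differs from both its neighbours, so each of the two links depends on x_i through one end
   only. *)
rewrite ord_predK eqxx eq_sym (negPf (ordS_neq hN _)) eq_sym (negPf (ord_pred_neq hN _)).
rewrite /= mulr1n mulr0n /ddlogmu; move: (link i x) (link (ord_pred i) x) => p q.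
by field; exact: x0.
Qed.

Definition hop i x : R :=
  (x 0 i ^+ 2 + x 0 (ordS i) ^+ 2) / (x 0 i ^+ 2 - x 0 (ordS i) ^+ 2) ^+ 2.

Definition pot0 x : R := w ^+ 2 * r2 x.
Definition pot1 x : R := \sum_i b * (b - 1) / x 0 i ^+ 2.
Definition pot2 x : R := \sum_i 8 * a ^+ 2 * x 0 i ^+ 2 /
       ((x 0 i ^+ 2 - x 0 (ord_pred i) ^+ 2)
        * (x 0 i ^+ 2 - x 0 (ordS i) ^+ 2)).

(** Summation by parts around the cycle: the link from i to i + 1 collects z_i - z_{i+1}, which its
    own value inverts, so each of the N links contributes 1. *)
Lemma sum_sqr_link x : conf x ->
  \sum_i x 0 i ^+ 2 * (link i x - link (ord_pred i) x) = N%:R.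
Proof.
move=> cx; under eq_bigr => i _ do rewrite mulrBr.
have shift : \sum_i x 0 i ^+ 2 * link (ord_pred i) x = \sum_i x 0 (ordS i) ^+ 2 * link i x.
  rewrite -[RHS]sum_ord_pred; by apply: eq_bigr => i _; rewrite ord_predK.
rewrite sumrB shift -sumrB.
rewrite -[N in RHS]card_ord -sumr_const; apply: eq_bigr => i _.
by rewrite -mulrBl divff// link_den_neq0.
Qed.

Lemma sum_hop x :
  \sum_i x 0 i ^+ 2 * (link i x ^+ 2 + link (ord_pred i) x ^+ 2) = \sum_i hop i x.
Proof.
under eq_bigr => i _ do rewrite mulrDr.
have shift : \sum_i x 0 i ^+ 2 * link (ord_pred i) x ^+ 2 =
    \sum_i x 0 (ordS i) ^+ 2 * link i x ^+ 2.
  by rewrite -[RHS]sum_ord_pred; apply: eq_bigr => i _; rewrite ord_predK.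
rewrite big_split/= shift.
by rewrite -big_split/=; apply: eq_bigr => i _; rewrite -mulrDl exprVn.
Qed.

(* The two-body terms of the potential come from the squares and the three-body terms from
   the cross terms of [dlogmu]; the rest telescopes around the cycle. *)
Lemma gauge_potential x : conf x ->
  \sum_i (ddlogmu i x + dlogmu i x ^+ 2) =
  pot0 x + pot1 x + pot2 x + 4 * a * (a - 1) * (\sum_i hop i x) - E0 N a b w.
Proof.
(* The last three summands produce the ground energy: the link differences sum to 0, their
   z-weighted sum is N, and the total is -N w (4a + 2b + 1). *)
move=> cx; transitivity (\sum_i (w ^+ 2 * x 0 i ^+ 2 + b * (b - 1) / x 0 i ^+ 2
  + 8 * a ^+ 2 * x 0 i ^+ 2 / ((x 0 i ^+ 2 - x 0 (ord_pred i) ^+ 2)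
        * (x 0 i ^+ 2 - x 0 (ordS i) ^+ 2))
  + 4 * a * (a - 1) * (x 0 i ^+ 2 * (link i x ^+ 2 + link (ord_pred i) x ^+ 2))
  + (2 * a + 4 * a * b) * (link i x - link (ord_pred i) x)
  + (- 4 * a * w) * (x 0 i ^+ 2 * (link i x - link (ord_pred i) x))
  + (- w - 2 * w * b))).
  apply: eq_bigr => i _.
  have -> : 8 * a ^+ 2 * x 0 i ^+ 2 / ((x 0 i ^+ 2 - x 0 (ord_pred i) ^+ 2)
        * (x 0 i ^+ 2 - x 0 (ordS i) ^+ 2))
      = - (8 * a ^+ 2 * x 0 i ^+ 2) * (link i x * link (ord_pred i) x).
    have := link_den_neq0 i cx; have := link_den_neq0 (ord_pred i) cx.
    rewrite /link ord_predK -[x 0 i ^+ 2 - x 0 (ord_pred i) ^+ 2]opprB.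
    by move: (_ - _ : R) (x 0 i ^+ 2 - _) => p q p0 q0; field; rewrite p0 q0.
  rewrite /ddlogmu /dlogmu; move: (link i x) (link (ord_pred i) x) => p q.
  by field; rewrite gt_eqF ?config_gt0.
have shift : \sum_i link (ord_pred i) x = \sum_i link i x := sum_ord_pred (link^~ x).
rewrite /pot0 /pot1 /pot2 /E0 /r2 !big_split/= -!mulr_sumr sum_hop sum_sqr_link//.
rewrite sumrB shift subrr !sumr_const card_ord.
rewrite -[- w *+ N]mulr_natl -[- (2 * w * b) *+ N]mulr_natl.
by ring.
Qed.

(** Conjugation of the Laplacian D by mu: D(mu G) / mu = D G + 2 grad(log mu) . grad G + (D log mu +
    |grad log mu|^2) G. *)
Lemma sum_pd_mu (G : point -> R) (G1 G2 : 'I_N -> point -> R) x :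
  (forall i, has_pd i G (G1 i)) -> (forall i, has_pd i (G1 i) (G2 i)) ->
  conf x ->
  \sum_i pd i (pd i (fun y => mu a b w y * G y)) x =
  mu a b w x * (\sum_i (G2 i x + 2 * dlogmu i x * G1 i x)
    + (\sum_i (ddlogmu i x + dlogmu i x ^+ 2)) * G x).
Proof.
move=> GG1 G1G2 cx; rewrite mulr_suml -big_split/= mulr_sumr.
apply: eq_bigr => i _; have m := has_pd_mu i.
rewrite (pd_pd (has_pdM m (GG1 i)) (has_pdD (has_pdM m (G1G2 i))
  (has_pdM (GG1 i) (has_pdM m (has_pd_dlogmu i)))))//.
by ring.
Qed.

End Gauge.

(** * Laguerre polynomials *)

Section Laguerre.
Variable R : realType.
Implicit Type nu : R.

Definition lag_coef nu k j : R := (-1) ^+ j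
    * ((\prod_(i < k - j) (nu + j%:R + i.+1%:R)) / (k - j)`!%:R) / j`!%:R.

Definition lagP nu k : {poly R} := \poly_(j < k.+1) lag_coef nu k j.

Lemma laguerreE nu k t : laguerre nu k t = (lagP nu k).[t].
Proof.
rewrite horner_poly; apply: eq_bigr => j _.
by rewrite /lag_coef -!mulrA [t ^+ j / _]mulrC.
Qed.

Lemma fact_neq0 n : n`!%:R != 0 :> R.
Proof. by rewrite pnatr_eq0 -lt0n fact_gt0. Qed.

(** The product for j has exactly one factor more than the one for j + 1, namely nu + j + 1; the
    factorials account for the rest of the ratio. *)
Lemma lag_coefS nu k j : (j < k)%N ->
  (j%:R + 1) * (j%:R + 1 + nu) * lag_coef nu k j.+1 = - (k - j)%:R * lag_coef nu k j.
Proof.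
move=> jk; rewrite /lag_coef -(subnSK jk); set n := (k - j.+1)%N.
rewrite big_ord_recl !factS !natrM exprS.
have -> : \prod_(i < n) (nu + j%:R + (bump 0 i).+1%:R) =
    \prod_(i < n) (nu + j.+1%:R + i.+1%:R).
  by apply: eq_bigr => i _; rewrite /bump add1n -!natr1; ring.
move: (\prod_(i < n) _) => P.
have := fact_neq0 n; have := fact_neq0 j; move: n`!%:R j`!%:R => u v v0 u0.
have n0 : n.+1%:R != 0 :> R by rewrite pnatr_eq0.
have j0 : j.+1%:R != 0 :> R by rewrite pnatr_eq0.
move: n0 j0; rewrite -!natr1 => n0 j0.
by rewrite /=; field; rewrite v0 u0 j0 n0.
Qed.

Lemma size_lagP nu k : size (lagP nu k) = k.+1.
Proof.
rewrite size_poly_eq// /lag_coef subnn big_ord0 fact0 mul1r invr1 mulr1.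
by rewrite mulf_neq0 ?invr_eq0 ?fact_neq0// signr_eq0.
Qed.

(** Compared coefficientwise: below degree k this is [lag_coefS], at degree k the contributions of
    -t p' and k p cancel, and above it all terms vanish. *)
Lemma lagP_ode nu k t : t * (lagP nu k)^`()^`().[t]
  + (nu + 1 - t) * (lagP nu k)^`().[t] + k%:R * (lagP nu k).[t] = 0.
Proof.
set p := lagP nu k.
have : 'X * p^`()^`() + ((nu + 1)%:P - 'X) * p^`() + k%:R *: p = 0.
  apply/polyP => j; rewrite !coefD mulrBl coefB !coefXM coefCM coefZ !coef_deriv coef0.
  have pj l : p`_l = if (l < k.+1)%N then lag_coef nu k l else 0 by rewrite coef_poly.
  have -> : (if j == 0%N then 0 else p`_j.-1.+2 *+ j.-1.+2 *+ j.-1.+1)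
            = j%:R * (j.+1%:R * p`_j.+1).
    by case: j => [|j]; rewrite /= ?mulr0n ?mul0r// !mulr_natl.
  have -> : (if j == 0%N then 0 else p`_j.-1.+1 *+ j.-1.+1) = j%:R * p`_j.
    by case: j => [|j]; rewrite /= ?mulr0n ?mul0r// !mulr_natl.
  rewrite -[p`_j.+1 *+ _]mulr_natl.
  have [jk|kj|->] := ltngtP j k.
  - have := lag_coefS nu jk; rewrite !pj !ltnS jk (ltnW jk) natrB ?(ltnW jk)//.
    move=> E; transitivity ((j%:R + 1) * (j%:R + 1 + nu) * lag_coef nu k j.+1
      + (k%:R - j%:R) * lag_coef nu k j); first by rewrite -natr1; ring.
    by rewrite E; ring.
  - by rewrite !pj !ltnS (ltn_geF kj) (leq_gtF (ltnW kj)); ring.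
  - by rewrite !pj !ltnS ltnn leqnn; ring.
by move=> /(congr1 (fun q : {poly R} => q.[t])); rewrite !hornerE.
Qed.

End Laguerre.

(** * Separation of the real and imaginary parts *)

Section Parts.
Variable R : realType.

(** Both parts under one Boolean index, so that each argument on real components is made once for
    the two. *)
Definition cpart (e : bool) (z : R[i]) : R := if e then complex.Im z else complex.Re z.

Lemma cpart_inj (z t : R[i]) : (forall e, cpart e z = cpart e t) -> z = t.
Proof.
by case: z t => [z1 z2] [t1 t2] h; have := h true; have := h false => /= -> ->.
Qed.

Lemma cpartD e z t : cpart e (z + t) = cpart e z + cpart e t.
Proof. by case: e z t => -[z1 z2] [t1 t2]. Qed.

Lemma cpartN e z : cpart e (- z) = - cpart e z.
Proof. by case: e z => -[z1 z2]. Qed.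

Lemma cpartZ e (r : R) z : cpart e (r%:C * z) = r * cpart e z.
Proof. by case: e z => -[z1 z2] /=; rewrite mul0r ?addr0 ?subr0. Qed.

Lemma cpart_natl e n z : cpart e (n%:R * z) = n%:R * cpart e z.
Proof.
rewrite !mulr_natl; elim: n => [|n IH]; first by rewrite !mulr0n; case: e.
by rewrite !mulrS cpartD IH.
Qed.

Lemma cpart_sum e (I : Type) (r : seq I) (P : pred I) (F : I -> R[i]) :
  cpart e (\sum_(i <- r | P i) F i) = \sum_(i <- r | P i) cpart e (F i).
Proof.
by apply: (big_morph (cpart e) (cpartD e)); case: e.
Qed.

End Parts.

(** * The Hamiltonian on real components and its radial reduction *)

Section RealHamiltonian.
Variables (R : realType) (N m : nat) (hN : (1 < N)%N) (a b w : R).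
Local Notation point := 'rV[R]_N.
Local Notation conf := (@config R N).
Local Notation spins := (spins N m).
Implicit Types (x : point) (i j : 'I_N) (s : spins) (F : wave R N m).

Definition swap_spin i s : spins := [ffun j => s (tperm i (ordS i) j)].

Definition realH (f : spins -> point -> R) s x : R :=
  - (\sum_i pd i (pd i (f s)) x) + pot0 w x * f s x + pot1 b x * f s x
  + pot2 a x * f s x
  + 4 * a * \sum_i hop i x * (a * f s x - f (swap_spin i s) x).

Lemma SigmaD (u v : Sigma R N m) s : (u + v) s = u s + v s.
Proof. exact: ffunE. Qed.

Lemma SigmaN (u : Sigma R N m) s : (- u) s = - u s.
Proof. exact: ffunE. Qed.

Lemma SigmaZ c (u : Sigma R N m) s : (c *: u) s = c * u s.
Proof. exact: ffunE. Qed.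

Lemma Sigma_sum (I : Type) (r : seq I) (P : pred I) (u : I -> Sigma R N m) s :
  (\sum_(i <- r | P i) u i) s = \sum_(i <- r | P i) u i s.
Proof. exact: sum_ffunE. Qed.

Lemma cpart_pdW e i F x s :
  cpart e (pdW i F x s) = pd i (fun y => cpart e (F y s)) x.
Proof. by rewrite ffunE; case: e. Qed.

Lemma cpart_H1 e F x s :
  cpart e (H1 a b w F x s) = realH (fun s y => cpart e (F y s)) s x.
Proof.
rewrite /H1 /realH !SigmaD SigmaN !SigmaZ !Sigma_sum !cpartD cpartN !cpartZ !cpart_sum.
congr (- _ + _ + _ + _ + _ * _).
  apply: eq_bigr => i _; rewrite cpart_pdW; congr (pd _ _ _).
  by apply/funext => y; rewrite cpart_pdW.
apply: eq_bigr => i _; rewrite SigmaZ SigmaD SigmaN SigmaZ cpartZ cpartD cpartN cpartZ.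
by rewrite /S_ /spin_perm ffunE.
Qed.

Lemma realH_mu (G : spins -> point -> R) (G1 G2 : spins -> 'I_N -> point -> R) s x :
  (forall i, has_pd i (G s) (G1 s i)) -> (forall i, has_pd i (G1 s i) (G2 s i)) ->
  conf x ->
  realH (fun s y => mu a b w y * G s y) s x =
  mu a b w x * (E0 N a b w * G s x
    - \sum_i (G2 s i x + 2 * dlogmu a b w i x * G1 s i x)
    + 4 * a * \sum_i hop i x * (G s x - G (swap_spin i s) x)).
Proof.
move=> GG1 G1G2 cx; rewrite /realH (sum_pd_mu hN a b w GG1 G1G2)//.
rewrite gauge_potential//.
(* Split a - S as (a - 1) + (1 - S): the first part cancels the two-body term produced by the gauge
   factor, and only 1 - S survives. *)
have -> : \sum_i hop i x * (a * (mu a b w x * G s x) - mu a b w x * G (swap_spin i s) x)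
    = mu a b w x * ((a - 1) * (\sum_i hop i x) * G s x
                    + \sum_i hop i x * (G s x - G (swap_spin i s) x)).
  rewrite mulr_sumr mulr_suml -big_split mulr_sumr/=.
  by apply: eq_bigr => i _; ring.
by ring.
Qed.

(** The Euler operator in x applied to log mu: the Gaussian contributes -w r^2 and the homogeneous
    prefactor its degree N (2a + b). *)
Lemma sum_coord_dlogmu x : conf x ->
  \sum_i x 0 i * dlogmu a b w i x = - w * r2 x + 2 * a * N%:R + N%:R * b.
Proof.
move=> cx; have -> : N%:R * b = \sum_(i < N) b by rewrite sumr_const card_ord mulr_natl.
rewrite -(sum_sqr_link hN cx) /r2 !mulr_sumr -!big_split/=; apply: eq_bigr => i _; rewrite /dlogmu.
by field; rewrite gt_eqF ?config_gt0.
Qed.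

(* Homogeneous of degree 2 d and annihilated by the scale-invariant part of the
   gauged Hamiltonian. *)
Record null_state (d : nat) (chi : spins -> point -> R) : Prop := NullState {
  null_Ck : forall s k, Ck k (chi s);
  null_pde : exists chi1 chi2 : spins -> 'I_N -> point -> R,
    [/\ forall s i, has_pd i (chi s) (chi1 s i),
        forall s i, has_pd i (chi1 s i) (chi2 s i),
        forall s x, conf x -> \sum_i x 0 i * chi1 s i x = (2 * d)%:R * chi s x &
        forall s x, conf x ->
          \sum_i (chi2 s i x + 2 * (dlogmu a b w i x + w * x 0 i) * chi1 s i x)
          = 4 * a * \sum_i hop i x * (chi s x - chi (swap_spin i s) x)] }.

(** In the variable t = w r^2 the coefficient of p' is alpha + 2d - t: N/2 comes from the Laplacian
    of r^2, N (2a + b) - t from [sum_coord_dlogmu], and 2d from the cross term with the homogeneous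
    chi. The oscillator drift acting on chi adds 4 w d to the energy. *)
Lemma realH_radial d chi k s x : null_state d chi -> conf x ->
  let f s y := mu a b w y *
    ((lagP (alpha N a b - 1 + (2 * d)%:R) k).[w * r2 y] * chi s y) in
  realH f s x = energy N a b w (k + d) * f s x.
Proof.
move=> [_ [chi1 [chi2 [c1 c2 euler null]]]] cx /=.
set p := lagP _ k.
have r i : has_pd i (fun y => w * r2 y) (fun y => 2 * w * y 0 i).
  apply: has_pd_eqc (has_pdZ w (has_pd_r2 i)) => // y _; ring.
have q i : has_pd i (fun y => p.[w * r2 y]) _ := has_pd_horner p (r i).
have q' i : has_pd i (fun y => p^`().[w * r2 y]) _ := has_pd_horner p^`() (r i).
have lin i : has_pd i (fun y : point => 2 * w * y 0 i) (fun=> 2 * w).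
  by apply: has_pd_eqc (has_pdZ (2 * w) (has_pd_coord i i)) => // y _; rewrite eqxx mulr1.
have G1 s' i := has_pdM (q i) (c1 s' i).
have G2 s' i := has_pdD (has_pdM (q i) (c2 s' i))
  (has_pdM (c1 s' i) (has_pdM (q' i) (lin i))).
rewrite (@realH_mu (fun s' y => p.[w * r2 y] * chi s' y) (fun s' i y => _)
  (fun s' i y => _) s x (G1 s) (G2 s) cx) [RHS]mulrCA.
congr (_ * _); have := null s x cx; have := euler s x cx.
set A := \sum_i x 0 i * _; set B := \sum_i (chi2 s i x + _).
have := lagP_ode (alpha N a b - 1 + (2 * d)%:R) k (w * r2 x); rewrite -/p.
set t := w * r2 x; set y0 := p.[t]; set y1 := p^`().[t]; set y2 := p^`()^`().[t].
move=> ode eA eB.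
have -> : \sum_i hop i x * (y0 * chi s x - y0 * chi (swap_spin i s) x)
    = y0 * \sum_i hop i x * (chi s x - chi (swap_spin i s) x).
  by rewrite mulr_sumr; apply: eq_bigr => i _; ring.
(* The drift is split into its scale-invariant part, collected in B, and -w x_i, which yields the
   multiple -2 w y0 of the Euler sum A. *)
transitivity (E0 N a b w * (y0 * chi s x) - (y0 * B + 4 * w ^+ 2 * y2 * chi s x * r2 x
   + N%:R * (2 * w * y1 * chi s x) + 4 * w * y1 * chi s x * (\sum_i x 0 i * dlogmu a b w i x)
   + (4 * w * y1 - 2 * w * y0) * A)
   + y0 * (4 * a * \sum_i hop i x * (chi s x - chi (swap_spin i s) x))).
  congr (_ - _ + _); last by ring.
  have -> : N%:R * (2 * w * y1 * chi s x) = \sum_(i < N) 2 * w * y1 * chi s x.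
    by rewrite sumr_const card_ord mulr_natl.
  rewrite /A /B /r2 !mulr_sumr -!big_split/=; apply: eq_bigr => i _.
  by rewrite -/t -/y0 -/y1 -/y2; ring.
rewrite sum_coord_dlogmu// -eB eA /energy natrM natrD.
transitivity (E0 N a b w * (y0 * chi s x) - 4 * w * chi s x *
  (t * y2 + (alpha N a b - 1 + (2 * d)%:R + 1 - t) * y1 - d%:R * y0)).
  by rewrite /t /alpha natrM; field.
have -> : t * y2 + (alpha N a b - 1 + (2 * d)%:R + 1 - t) * y1 = - (k%:R * y0).
  by apply/eqP; rewrite -subr_eq0 opprK ode.
by ring.
Qed.

End RealHamiltonian.

(** * The three families of eigenfunctions *)

Section NullStates.
Variables (R : realType) (N m : nat) (hN : (1 < N)%N) (a b w : R).
Local Notation point := 'rV[R]_N.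
Local Notation conf := (@config R N).
Local Notation spins := (spins N m).
Local Notation null_state := (@null_state R N m a b w).
Implicit Types (x : point) (i j : 'I_N) (s : spins).

Lemma null_state0 (c : spins -> R) :
  (forall i s, c (swap_spin i s) = c s) -> null_state 0 (fun s _ => c s).
Proof.
move=> cS; split=> [s k|]; first exact: Ck_cst.
exists (fun _ _ _ => 0), (fun _ _ _ => 0); split=> [s i|s i|s x _|s x _].
- exact: has_pd_cst.
- exact: has_pd_cst.
- by rewrite big1 ?mul0r// => i _; rewrite mulr0.
- by rewrite !big1 ?mulr0// => i _; rewrite ?cS ?subrr ?mulr0 ?addr0.
Qed.

(** The transposition affects two terms only. The resulting factor z_i - z_{i+1} lowers the double
    pole of [hop] to a simple one. *)
Lemma sum_swap (c : 'I_N -> R) i x :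
  \sum_j x 0 j ^+ 2 * c j - \sum_j x 0 j ^+ 2 * c (tperm i (ordS i) j) =
  (x 0 i ^+ 2 - x 0 (ordS i) ^+ 2) * (c i - c (ordS i)).
Proof.
have iS := ordS_neq hN i.
rewrite -sumrB (bigD1 i)//= (bigD1 (ordS i))//= big1 => [|j /andP[ji jS]].
  by rewrite tpermL tpermR; ring.
by rewrite tpermD ?subrr// eq_sym.
Qed.

(** The operator sends a linear form in z to (2 + 4b + 8a) times the sum of its coefficients, hence
    the second hypothesis; the first turns spin exchange into exchange of coefficients. *)
Lemma null_state1 (c : spins -> 'I_N -> R) :
  (forall i s j, c (swap_spin i s) j = c s (tperm i (ordS i) j)) ->
  (forall s, \sum_j c s j = 0) ->
  null_state 1 (fun s x => \sum_j x 0 j ^+ 2 * c s j).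
Proof.
move=> cS c0; split=> [s k|].
  by apply: Ck_sum => j; apply: CkM; [apply: CkX; exact: Ck_coord|exact: Ck_cst].
exists (fun s i x => 2 * x 0 i * c s i), (fun s i _ => 2 * c s i).
split=> [s i|s i|s x cx|s x cx].
- have := has_pd_sum (index_enum 'I_N) (fun j =>
    has_pdM (has_pd_sqr_coord i j) (has_pd_cst i (c s j))).
  apply: has_pd_eqc => x _ //; rewrite -(sum_delta (fun j => 2 * x 0 j * c s j)).
  by apply: eq_bigr => j _; ring.
- have := has_pdM (has_pdZ 2 (has_pd_coord i i)) (has_pd_cst i (c s i)).
  by apply: has_pd_eqc => x _ //; rewrite eqxx mulr1n; ring.
- by rewrite mulr_sumr; apply: eq_bigr => i _; ring.
- transitivity (\sum_i ((2 + 4 * b) * c s i + 8 * a *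
      (x 0 i ^+ 2 * c s i * link i x - x 0 i ^+ 2 * c s i * link (ord_pred i) x))).
    apply: eq_bigr => i _; rewrite /dlogmu.
    by field; rewrite gt_eqF ?config_gt0.
  rewrite big_split/= -mulr_sumr c0 mulr0 add0r -mulr_sumr sumrB.
  have shift : \sum_i x 0 i ^+ 2 * c s i * link (ord_pred i) x =
      \sum_i x 0 (ordS i) ^+ 2 * c s (ordS i) * link i x.
    by rewrite -[RHS]sum_ord_pred; apply: eq_bigr => i _; rewrite ord_predK.
  have c0S : \sum_i c s (ordS i) = 0.
    by rewrite -[RHS](c0 s) -[LHS]sum_ord_pred; apply: eq_bigr => i _; rewrite ord_predK.
  rewrite shift -sumrB; apply/eqP; rewrite -subr_eq0; apply/eqP.
  (* On each link, 2 (z_i c_i - z_{i+1} c_{i+1}) - (z_i + z_{i+1}) (c_i - c_{i+1}) = (z_i - z_{i+1})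
     (c_i + c_{i+1}), which removes the remaining pole. *)
  transitivity (4 * a * (\sum_i c s i + \sum_i c s (ordS i))); last first.
    by rewrite c0 c0S addr0 mulr0.
  rewrite -big_split !mulr_sumr -sumrB; apply: eq_bigr => i _ /=.
  under [in X in hop _ _ * (_ - X)]eq_bigr do rewrite cS.
  rewrite sum_swap /hop /link; have := link_den_neq0 hN i cx.
  by move=> d0; field.
Qed.

(** As in [sum_sqr_link], but each link now contributes z_i + z_{i+1}, so every site is counted
    twice. *)
Lemma sum_pow4_link x : conf x ->
  \sum_i x 0 i ^+ 4 * (link i x - link (ord_pred i) x) = 2 * r2 x.
Proof.
move=> cx; under eq_bigr => i _ do rewrite mulrBr.
have shift : \sum_i x 0 i ^+ 4 * link (ord_pred i) x = \sum_i x 0 (ordS i) ^+ 4 * link i x.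
  by rewrite -[RHS]sum_ord_pred; apply: eq_bigr => i _; rewrite ord_predK.
have shift2 : \sum_i x 0 (ordS i) ^+ 2 = r2 x.
  by rewrite -[LHS]sum_ord_pred; apply: eq_bigr => i _; rewrite ord_predK.
rewrite sumrB shift -sumrB mulr_natl mulr2n -{2}shift2 -big_split/=.
apply: eq_bigr => i _; rewrite /link; have := link_den_neq0 hN i cx.
by move=> d0; field.
Qed.

(** Invariance of c removes the exchange terms. With A and B the two coefficients, the telescoped
    sums leave 4 c r^2 (A (8a + 2b + 3) - B (N (4a + 2b + 1) + 2)), whose inner factors are 2 beta /
    N and 2 (alpha + 1). *)
Lemma null_state2 (c : spins -> R) :
  (forall i s, c (swap_spin i s) = c s) ->
  null_state 2 (fun s x => c s * (N%:R * (alpha N a b + 1) * (\sum_i x 0 i ^+ 4)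
                                  - beta N a b * r2 x ^+ 2)).
Proof.
move=> cS; set A := N%:R * _; set B := beta _ _ _.
split=> [s k|].
  apply: CkM; first exact: Ck_cst.
  apply: (@Ck_eqc _ _ _ (fun x => A * (\sum_i x 0 i ^+ 4) + (- B) * r2 x ^+ 2)).
    by move=> x _; rewrite mulNr.
  apply: CkD; apply: CkM; try exact: Ck_cst.
    by apply: Ck_sum => j; apply: CkX; exact: Ck_coord.
  by apply: CkX; exact: Ck_r2.
exists (fun s i x => c s * (4 * A * x 0 i ^+ 3 - 4 * B * r2 x * x 0 i)),
  (fun s i x => c s * (12 * A * x 0 i ^+ 2 - 4 * B * (2 * x 0 i ^+ 2 + r2 x))).
split=> [s i|s i|s x cx|s x cx].
- have H := has_pdZ (c s) (has_pdD (has_pdZ A (has_pd_sum (index_enum 'I_N)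
     (fun j => has_pdX2 (has_pd_sqr_coord i j))))
     (has_pdZ (- B) (has_pdX2 (@has_pd_r2 R N i)))).
  apply: has_pd_eqc H => x _.
    rewrite mulNr; congr (_ * (_ * _ - _)); apply: eq_bigr => j _; ring.
  congr (_ * _); have -> : 4 * A * x 0 i ^+ 3 = A * (4 * x 0 i ^+ 3) by ring.
  rewrite -(sum_delta (fun j => 4 * x 0 j ^+ 3) i).
  congr (_ * _ + _); last by ring.
  by apply: eq_bigr => j _; ring.
- have co := @has_pd_coord R N i i.
  have H := has_pdZ (c s) (has_pdD (has_pdZ (4 * A) (has_pdM co (has_pdX2 co)))
     (has_pdZ (- (4 * B)) (has_pdM (@has_pd_r2 R N i) co))).
  by apply: has_pd_eqc H => x _; rewrite ?eqxx ?mulr1n; ring.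
- transitivity (\sum_i (4 * c s * A * x 0 i ^+ 4 - 4 * c s * B * r2 x * x 0 i ^+ 2)).
    by apply: eq_bigr => i _; ring.
  by rewrite sumrB -!mulr_sumr -/(r2 x); ring.
- rewrite [in RHS]big1 ?mulr0; last by move=> i _; rewrite cS subrr mulr0.
  have sumc (z : R) : \sum_(i < N) z = N%:R * z by rewrite sumr_const card_ord mulr_natl.
  transitivity (\sum_i (((12 + 8 * b) * c s * A - 8 * c s * B) * x 0 i ^+ 2
     + (- 4 * c s * B * r2 x - 8 * b * c s * B * r2 x)
     + 16 * a * c s * A * (x 0 i ^+ 4 * (link i x - link (ord_pred i) x))
     - 16 * a * c s * B * r2 x * (x 0 i ^+ 2 * (link i x - link (ord_pred i) x)))).
    apply: eq_bigr => i _; rewrite /dlogmu.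
    have x0 : x 0 i != 0 by rewrite gt_eqF ?config_gt0.
    clearbody A B; move: (r2 x) (x 0 i) (c s) x0 => r y z y0; by field.
  rewrite sumrB !big_split/= -!mulr_sumr sum_pow4_link// sum_sqr_link// !sumc -/(r2 x).
  by rewrite /A /B /alpha /beta; field.
Qed.

End NullStates.

(** * From null states to spin eigenfunctions *)

Section Eigenfunctions.
Variables (R : realType) (N m : nat) (hN : (1 < N)%N) (a b w : R).
Local Notation point := 'rV[R]_N.
Local Notation conf := (@config R N).
Local Notation spins := (spins N m).
Implicit Types (x : point) (i j : 'I_N) (q : spins).

Lemma eigenfunction_radial d k chi (F : wave R N m) :
  (forall e, null_state a b w d (chi e)) ->
  (forall e q x, cpart e (F x q) = mu a b w x *
     (laguerre (alpha N a b - 1 + (2 * d)%:R) k (w * r2 x) * chi e q x)) ->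
  eigenfunction (H1 a b w) (energy N a b w (k + d)) F.
Proof.
move=> null FE.
have FE' e q : (fun x => cpart e (F x q)) = fun x => mu a b w x *
     ((lagP (alpha N a b - 1 + (2 * d)%:R) k).[w * r2 x] * chi e q x).
  by apply/funext => x; rewrite FE laguerreE.
split=> [q k'|x cx].
  have C e : Ck k' (fun x => cpart e (F x q)).
    rewrite FE'; apply: CkM; first exact: Ck_mu.
    apply: CkM; last by have [+ _] := null e; apply.
    by apply/Ck_horner/CkM; [exact: Ck_cst|exact: Ck_r2].
  by split; [exact: (C false)|exact: (C true)].
apply/ffunP => q; apply: cpart_inj => e.
rewrite SigmaZ cpartZ cpart_H1 [cpart e _](FE e) laguerreE.
have -> : (fun q y => cpart e (F y q)) = (fun q y => mu a b w y *
     ((lagP (alpha N a b - 1 + (2 * d)%:R) k).[w * r2 y] * chi e q y)).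
  by apply/funext => q'; exact: FE'.
exact: realH_radial.
Qed.

Variables (i1 : 'I_N) (v : Sigma R N m).

(* The coefficient of [z_l] in [Phi 1]. *)
Definition site_state l q : R[i] :=
  (N`!%:R)^-1 * \sum_(p : 'S_N | p i1 == l) v [ffun i => q (p i)].

(** Grouping the permutations by the image l of the distinguished site collects a partial average of
    the spin state in front of each power of x_l. *)
Lemma PhiE n x q :
  Phi i1 v n x q = \sum_l (x 0 l ^+ (2 * n))%:C * site_state l q.
Proof.
rewrite /Phi /Lambda SigmaZ Sigma_sum.
rewrite (partition_big (fun p : 'S_N => p i1) xpredT)//= mulr_sumr.
apply: eq_bigr => l _; rewrite /site_state [RHS]mulrCA [in RHS]mulr_sumr; congr (_ * _).
by apply: eq_bigr => p /eqP <-; rewrite ffunE SigmaZ !mxE.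
Qed.

(** Right translation by the transposition permutes the symmetric group and moves the image of the
    distinguished site: spin exchange becomes exchange of site labels. *)
Lemma site_state_swap i q l :
  site_state l (swap_spin i q) = site_state (tperm i (ordS i) l) q.
Proof.
rewrite /site_state; congr (_ * _); rewrite [RHS](reindex_inj (mulIg (tperm i (ordS i))))/=.
apply: eq_big => [p|p _]; first by rewrite permM (inj_eq perm_inj).
by congr (v _); apply/ffunP => j; rewrite !ffunE permM.
Qed.

Definition total_state q := \sum_l site_state l q.

Lemma total_state_swap i q : total_state (swap_spin i q) = total_state q.
Proof.
rewrite /total_state [RHS](reindex_inj (@perm_inj _ (tperm i (ordS i))))/=.
by apply: eq_bigr => l _; rewrite site_state_swap.
Qed.

Lemma Phi0E x q : Phi i1 v 0 x q = total_state q.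
Proof. by rewrite PhiE; apply: eq_bigr => l _; rewrite expr0 mul1r. Qed.

Lemma Psi0_eigen k :
  eigenfunction (H1 a b w) (energy N a b w k) (Psi0 i1 v a b w k).
Proof.
rewrite -[k in energy _ _ _ _ k]addn0.
apply: (@eigenfunction_radial 0 k (fun e q _ => cpart e (total_state q))) => [e|e q x].
  by apply: null_state0 => i q; rewrite total_state_swap.
by rewrite /Psi0 /muW SigmaZ SigmaZ Phi0E !cpartZ muln0 addr0.
Qed.

Lemma cpart_comb e n (r : R) (u u' : Sigma R N m) q z z' : u q = z -> u' q = z' ->
  cpart e ((n%:R *: u - r%:C *: u') q) = n%:R * cpart e z - r * cpart e z'.
Proof. by move=> <- <-; rewrite SigmaD SigmaN !SigmaZ cpartD cpartN cpart_natl cpartZ. Qed.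

Lemma Psi1_eigen k : (1 <= k)%N ->
  eigenfunction (H1 a b w) (energy N a b w k) (Psi1 i1 v a b w k).
Proof.
move=> k1; rewrite -[k in energy _ _ _ _ k](subnK k1).
(* The coefficient of z_l in N Phi^(1) - sigma_1 Phi^(0). *)
pose c e q l := N%:R * cpart e (site_state l q) - cpart e (total_state q).
apply: (@eigenfunction_radial 1 _ (fun e q x => \sum_l x 0 l ^+ 2 * c e q l)) => [e|e q x].
  apply: null_state1 => // [i q l|q].
    by rewrite /c site_state_swap total_state_swap.
  rewrite sumrB -mulr_sumr sumr_const card_ord -cpart_sum.
  by rewrite -[cpart _ _ *+ N]mulr_natl subrr.
rewrite /Psi1 /muW SigmaZ SigmaZ cpartZ cpartZ.
rewrite (cpart_comb _ _ _ (PhiE 1 x q) (Phi0E x q)) cpart_sum.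
congr (_ * (laguerre _ _ _ * _)).
  by rewrite muln1; ring.
rewrite /r2 mulr_sumr mulr_suml -sumrB; apply: eq_bigr => l _.
by rewrite muln1 cpartZ /c; ring.
Qed.

Lemma Psi2_eigen k : (2 <= k)%N ->
  eigenfunction (H1 a b w) (energy N a b w k) (Psi2 i1 v a b w k).
Proof.
move=> k2; rewrite -[k in energy _ _ _ _ k](subnK k2).
apply: (eigenfunction_radial (chi := fun e q x => cpart e (total_state q) *
  (N%:R * (alpha N a b + 1) * (\sum_i x 0 i ^+ 4) - beta N a b * r2 x ^+ 2))) => [e|e q x].
  by apply: null_state2 => // i q; rewrite total_state_swap.
rewrite /Psi2 /muW SigmaZ SigmaZ SigmaZ Phi0E cpartZ cpartZ cpartZ.
congr (_ * (laguerre _ _ _ * _)).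
  by rewrite natrM; ring.
by rewrite mulrC.
Qed.

End Eigenfunctions.

(** * Spans *)

Section Spans.
Variables (R : realType) (N m : nat).
Local Notation W := (wave R N m).
Local Notation conf := (@config R N).
Implicit Types (V G : set W) (F : W).

(** Complex subspaces of functions considered on the chamber only, whence the closure condition
    [lin_ext]. *)
Record lin_set V : Prop := LinSet {
  lin_ext : forall F F', (forall x, conf x -> F x = F' x) -> V F -> V F';
  lin0 : V (fun=> 0);
  linD : forall F F', V F -> V F' -> V (fun x => F x + F' x);
  linZ : forall (c : R[i]) F, V F -> V (fun x => c *: F x) }.

Lemma lin_sum V (I : Type) (r : seq I) (B : I -> W) : lin_set V ->
  (forall i, V (B i)) -> V (fun x => \sum_(i <- r) B i x).
Proof.
move=> linV VB; elim: r => [|i r IH].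
  by apply: lin_ext linV _ _ _ (lin0 linV) => x _; rewrite big_nil.
by apply: lin_ext linV _ _ _ (linD linV (VB i) IH) => x _; rewrite big_cons.
Qed.

Lemma cspan_min G V : lin_set V -> G `<=` V -> cspan G `<=` V.
Proof.
move=> linV GV F [d [c [B [GB FE]]]].
apply: (lin_ext linV (F := fun x => \sum_(i < d) c i *: B i x)).
  by move=> x cx; rewrite FE.
by apply: (lin_sum _ linV) => i; apply/(linZ linV)/GV.
Qed.

Lemma sub_cspan G : G `<=` cspan G.
Proof.
move=> F GF; exists 1%N, (fun=> 1), (fun=> F); split=> // x _.
by rewrite big_ord1 scale1r.
Qed.

Lemma lin_cspan G : lin_set (cspan G).
Proof.
split=> [F F' FF' [d [c [B [GB FE]]]]||F F' [d [c [B [GB FE]]]] [d' [c' [B' [GB' FE']]]]|].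
- by exists d, c, B; split=> // x cx; rewrite -FF'// FE.
- exists 0%N, (fun=> 0), (fun=> fun=> 0); split=> [[]//|x _].
  by rewrite big_ord0.
- exists (d + d')%N, (fun i => match fintype.split i with inl j => c j | inr j => c' j end),
    (fun i => match fintype.split i with inl j => B j | inr j => B' j end); split=> [i|x cx].
    by case: fintype.split.
  rewrite big_split_ord/= FE// FE'//; congr (_ + _); apply: eq_bigr => i _.
    by rewrite -[lshift _ _]/(unsplit (inl i)) unsplitK.
  by rewrite -[rshift _ _]/(unsplit (inr i)) unsplitK.
- move=> z F [d [c [B [GB FE]]]]; exists d, (fun i => z * c i), B; split=> // x cx.
  by rewrite FE// scaler_sumr; apply: eq_bigr => i _; rewrite scalerA.
Qed.

Lemma lin_horner V (Y : W) (t : 'rV[R]_N -> R[i]) n (g : {poly R[i]}) : lin_set V ->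
  (forall j, (j < n)%N -> V (fun x => t x ^+ j *: Y x)) ->
  (size g <= n)%N -> V (fun x => g.[t x] *: Y x).
Proof.
move=> linV VY sg.
apply: (lin_ext linV (F := fun x => \sum_(i < n) g`_i *: (t x ^+ i *: Y x))).
  move=> x _; rewrite (horner_coef_wide _ sg) scaler_suml.
  by apply: eq_bigr => i _; rewrite scalerA.
by apply: (lin_sum _ linV) => i; apply/(linZ linV)/VY.
Qed.

Definition lagC (nu w : R) k : {poly R[i]} :=
  \poly_(j < k.+1) (lag_coef nu k j * w ^+ j)%:C.

Lemma lagCE nu w k t : (laguerre nu k (w * t))%:C = (lagC nu w k).[t%:C].
Proof.
rewrite laguerreE !horner_poly rmorph_sum; apply: eq_bigr => j _ /=.
by rewrite -rmorphXn -rmorphM exprMn mulrA.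
Qed.

(** Induction on the degree bound: the n-th Laguerre polynomial has exact degree n, also after
    rescaling by w != 0, so a multiple of it removes the top coefficient of g. *)
Lemma lin_laguerre V (Y : W) (nu w : R) n (g : {poly R[i]}) : lin_set V -> w != 0 ->
  (forall j, (j < n)%N -> V (fun x => (laguerre nu j (w * r2 x))%:C *: Y x)) ->
  (size g <= n)%N -> V (fun x => g.[(r2 x)%:C] *: Y x).
Proof.
move=> linV w0; elim: n g => [|n IH] g VY sg.
  move: sg; rewrite leqn0 size_poly_eq0 => /eqP ->.
  by apply: lin_ext linV _ _ _ (lin0 linV) => x _; rewrite horner0 scale0r.
pose L := lagC nu w n; pose c := g`_n / L`_n.
have Ln : L`_n != 0.
  rewrite coef_poly ltnSn; have -> : (0 : R[i]) = (0 : R)%:C by [].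
  rewrite (inj_eq (@complexI _)) mulf_neq0 ?expf_neq0//.
  have : lead_coef (lagP nu n) != 0 by rewrite lead_coef_eq0 -size_poly_eq0 size_lagP.
  by rewrite lead_coefE size_lagP coef_poly ltnSn.
have gc : (size (g - c *: L)%R <= n)%N.
  apply/leq_sizeP => j; rewrite leq_eqVlt => /orP[/eqP <-|nj].
    by rewrite coefB coefZ divfK// subrr.
  rewrite coefB coefZ !nth_default ?mulr0 ?subrr//.
    exact: leq_trans (size_poly _ _) nj.
  exact: leq_trans sg nj.
have Vr := IH _ (fun j jn => VY j (ltnW jn)) gc.
apply: lin_ext linV _ _ _ (linD linV Vr (linZ linV c (VY n (ltnSn n)))) => x _.
by rewrite lagCE hornerD hornerN hornerZ scalerA -scalerDl subrK.
Qed.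

End Spans.

(** * Complex linearity of the Hamiltonian and invariance of spans *)

Section LinearHamiltonian.
Variables (R : realType) (N m : nat) (a b w : R).
Local Notation conf := (@config R N).
Local Notation spins := (spins N m).
Implicit Types (F : wave R N m).

Lemma realH_lin (f g : spins -> 'rV[R]_N -> R) (c d : R) s x :
  (forall s, Ck 2 (f s)) -> (forall s, Ck 2 (g s)) -> conf x ->
  realH a b w (fun s y => c * f s y + d * g s y) s x =
  c * realH a b w f s x + d * realH a b w g s x.
Proof.
move=> f2 g2 cx; have pd2 i : pd i (pd i (fun y => c * f s y + d * g s y)) x =
    c * pd i (pd i (f s)) x + d * pd i (pd i (g s)) x.
  have f1 : Ck 1 (pd i (f s)) by have [_ /(_ i)[]] := f2 s.
  have g1 : Ck 1 (pd i (g s)) by have [_ /(_ i)[]] := g2 s.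
  by rewrite (pd_pd (has_pdD (has_pdZ c (Ck_pd i (f2 s))) (has_pdZ d (Ck_pd i (g2 s))))
    (has_pdD (has_pdZ c (Ck_pd i f1)) (has_pdZ d (Ck_pd i g1)))).
have alg (S A B T A' B' p0 p1 p2 k u v : R) :
    S = c * A + d * B -> T = c * A' + d * B' ->
    - S + p0 * (c * u + d * v) + p1 * (c * u + d * v) + p2 * (c * u + d * v) + k * T =
    c * (- A + p0 * u + p1 * u + p2 * u + k * A')
    + d * (- B + p0 * v + p1 * v + p2 * v + k * B') by move=> -> ->; ring.
by apply: alg; rewrite !mulr_sumr -big_split/=; apply: eq_bigr => i _; [exact: pd2|ring].
Qed.

Lemma realH_eqc (f g : spins -> 'rV[R]_N -> R) s x :
  (forall s, eqc (f s) (g s)) -> conf x -> realH a b w f s x = realH a b w g s x.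
Proof.
move=> fg cx; have alg (S S' T T' p0 p1 p2 k u v : R) : S = S' -> u = v -> T = T' ->
    - S + p0 * u + p1 * u + p2 * u + k * T = - S' + p0 * v + p1 * v + p2 * v + k * T'.
  by move=> -> -> ->.
apply: alg; [apply: eq_bigr => i _|exact: fg|by apply: eq_bigr => i _; rewrite !fg].
exact: (pd_eqc i (pd_eqc i (fg s))).
Qed.

Lemma smooth_cpart F : smooth F <-> forall e s k, Ck k (fun x => cpart e (F x s)).
Proof.
split=> [sF [] s k|CF s k]; first by have [_ +] := sF s k; exact.
  by have [+ _] := sF s k; exact.
by split; [exact: (CF false)|exact: (CF true)].
Qed.

Lemma H1_eqc F F' x : (forall y, conf y -> F y = F' y) -> conf x ->
  H1 a b w F x = H1 a b w F' x.
Proof.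
move=> FF' cx; apply/ffunP => s; apply: cpart_inj => e.
apply: etrans (cpart_H1 a b w e F x s) _; apply: etrans _ (esym (cpart_H1 a b w e F' x s)).
by apply: realH_eqc => // s' y cy; rewrite FF'.
Qed.

Lemma H1D F F' x : smooth F -> smooth F' -> conf x ->
  H1 a b w (fun y => F y + F' y) x = H1 a b w F x + H1 a b w F' x.
Proof.
move=> /smooth_cpart sF /smooth_cpart sF' cx; apply/ffunP => s; apply: cpart_inj => e.
apply: etrans (cpart_H1 a b w e _ x s) _.
apply: etrans (realH_eqc
  (g := fun s y => 1 * cpart e (F y s) + 1 * cpart e (F' y s)) s _ cx) _.
  by move=> s' y _; rewrite SigmaD cpartD !mul1r.
apply: etrans (realH_lin 1 1 s (fun s' => sF e s' 2%N) (fun s' => sF' e s' 2%N) cx) _.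
apply: etrans (congr2 (fun u v => 1 * u + 1 * v) (esym (cpart_H1 a b w e F x s))
  (esym (cpart_H1 a b w e F' x s))) _.
have comb (u v : Sigma R N m) : 1 * cpart e (u s) + 1 * cpart e (v s) = cpart e ((u + v) s).
  by rewrite SigmaD cpartD !mul1r.
exact: comb.
Qed.

Lemma cpartM e (c z : R[i]) : cpart e (c * z) =
  cpart false c * cpart e z + (if e then 1 else -1) * cpart true c * cpart (~~ e) z.
Proof. by case: c z e => c1 c2 [z1 z2] [] /=; rewrite ?mul1r ?mulN1r ?mulNr. Qed.

(** A complex scalar mixes the two parts of F, so homogeneity over C follows from real linearity of
    [realH] on the pair of parts [e] and [~~ e]. *)
Lemma H1Z c F x : smooth F -> conf x ->
  H1 a b w (fun y => c *: F y) x = c *: H1 a b w F x.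
Proof.
move=> /smooth_cpart sF cx; apply/ffunP => s; apply: cpart_inj => e.
pose c1 := cpart false c; pose c2 := (if e then 1 else -1) * cpart true c.
apply: etrans (cpart_H1 a b w e _ x s) _.
apply: etrans (realH_eqc
  (g := fun s y => c1 * cpart e (F y s) + c2 * cpart (~~ e) (F y s)) s _ cx) _.
  by move=> s' y _; rewrite SigmaZ cpartM.
apply: etrans (realH_lin c1 c2 s (fun s' => sF e s' 2%N) (fun s' => sF (~~ e) s' 2%N) cx) _.
apply: etrans (congr2 (fun u v => c1 * u + c2 * v) (esym (cpart_H1 a b w e F x s))
  (esym (cpart_H1 a b w (~~ e) F x s))) _.
have comb (u : Sigma R N m) : c1 * cpart e (u s) + c2 * cpart (~~ e) (u s) = cpart e ((c *: u) s).
  by rewrite SigmaZ cpartM.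
exact: comb.
Qed.

Lemma smooth_eqc F F' : (forall y, conf y -> F y = F' y) -> smooth F -> smooth F'.
Proof.
move=> FF' /smooth_cpart sF; apply/smooth_cpart => e s k.
by apply: Ck_eqc (sF e s k) => x cx; rewrite FF'.
Qed.

Lemma smoothD F F' : smooth F -> smooth F' -> smooth (fun y => F y + F' y).
Proof.
move=> /smooth_cpart sF /smooth_cpart sF'; apply/smooth_cpart => e s k.
by apply: Ck_eqc (CkD (sF e s k) (sF' e s k)) => x _; rewrite SigmaD cpartD.
Qed.

Lemma smoothZ c F : smooth F -> smooth (fun y => c *: F y).
Proof.
move=> /smooth_cpart sF; apply/smooth_cpart => e s k.
apply: Ck_eqc (CkD (CkM (Ck_cst N k _) (sF e s k)) (CkM (Ck_cst N k _) (sF (~~ e) s k))) => x _.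
by rewrite SigmaZ cpartM.
Qed.

Lemma smooth0 : smooth ((fun=> 0) : wave R N m).
Proof.
by apply/smooth_cpart => e s k; apply: Ck_eqc (Ck_cst N k 0) => x _; rewrite ffunE; case: e.
Qed.

Lemma invariant_cspan (G : set (wave R N m)) :
  (forall F, G F -> exists E, eigenfunction (H1 a b w) E F) ->
  invariant_under (H1 a b w) (cspan G).
Proof.
move=> GE; have linG := lin_cspan G.
(* Smoothness is carried along because linearity of H_1 is available on smooth functions. *)
suff sub : cspan G `<=` [set F | smooth F /\ cspan G (H1 a b w F)].
  by move=> F /sub[].
apply: cspan_min => [|F GF].
  split=> [F F' FF' [sF VF]||F F' [sF VF] [sF' VF']|c F [sF VF]].
  - split; first exact: smooth_eqc sF.
    by apply: lin_ext linG _ _ _ VF => x cx; exact: H1_eqc.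
  - split; first exact: smooth0.
    apply: lin_ext linG _ _ _ (lin0 linG) => x cx.
    have z0 y : conf y -> (0 : Sigma R N m) = (0 : R[i]) *: 0 by rewrite scaler0.
    have E := etrans (H1Z 0 smooth0 cx) (scale0r _).
    exact: esym (etrans (H1_eqc z0 cx) E).
  - split; first exact: smoothD.
    by apply: lin_ext linG _ _ _ (linD linG VF VF') => x cx; exact/esym/H1D.
  - split; first exact: smoothZ.
    by apply: lin_ext linG _ _ _ (linZ linG c VF) => x cx; exact/esym/H1Z.
have [E [sF HF]] := GE F GF; split=> //.
by apply: lin_ext linG _ _ _ (linZ linG E%:C (sub_cspan GF)) => x cx; exact/esym/HF.
Qed.

End LinearHamiltonian.

(** * Polynomials in the power sums *)

Section PowerSums.
Variables (R : realType) (N : nat).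
Local Notation C := R[i].
Local Notation sig k := (sigma R N k).
Implicit Types (g : {poly C}) (h : mpoly N C) (c : 'I_N -> C).

Lemma subst1Z_Xn (z : C) k : subst1 N (z *: 'X^k) = z *: sig 1 ^+ k.
Proof. by rewrite /subst1 linearZ/= map_polyXn hornerZ hornerXn mul_mpolyC. Qed.

Lemma subst1D g g' : subst1 N (g + g') = subst1 N g + subst1 N g'.
Proof. by rewrite /subst1 rmorphD hornerD. Qed.

Lemma subst10 : subst1 N 0 = 0 :> mpoly N C.
Proof. by rewrite /subst1 rmorph0 horner0. Qed.

Lemma subst2_X (e : multinom 2) :
  subst2 N (mpolyX C e) = sig 1 ^+ e ord0 * sig 2 ^+ e (lift ord0 ord0).
Proof. by rewrite /subst2 comp_mpolyX big_ord_recl big_ord1 !(tnth_nth 0). Qed.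

(** In characteristic zero a vanishing second derivative bounds the exponent of that variable by 1
    in every monomial. *)
Lemma subst2_affine (f : mpoly 2 C) :
  mderiv (1%R : 'I_2) (mderiv (1%R : 'I_2) f) = 0 ->
  exists p q : {poly C}, subst2 N f = subst1 N p + subst1 N q * sig 2.
Proof.
move=> f2.
have deg1 (e : multinom 2) : e \in msupp f -> (e (1%R : 'I_2) <= 1)%N.
  rewrite mcoeff_msupp; apply: contraNT; rewrite -ltnNge => e1.
  (* The coefficient of the second derivative at [e'] is a nonzero integer multiple of that of f at
     [e]. *)
  pose e' := mnm_sub e (mnm_add (mnm1 (1%R : 'I_2)) (mnm1 (1%R : 'I_2))).
  have ee : e = mnm_add (mnm_add e' (mnm1 (1%R : 'I_2))) (mnm1 (1%R : 'I_2)).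
    rewrite -addmA submK//; apply/mnm_lepP => i; rewrite mnmDE !mnm1E.
    by case: eqP => [<-|_].
  have := congr1 (mcoeff e') f2; rewrite !mcoeff_deriv mcoeff0 -ee => /eqP.
  by rewrite -!mulrnA mulrn_eq0 muln_eq0.
have : forall r : seq (multinom 2), {subset r <= msupp f} -> exists p q : {poly C},
    \sum_(e <- r) mcoeff e f *: comp_mpoly [tuple sig 1; sig 2] (mpolyX C e)
    = subst1 N p + subst1 N q * sig 2.
  elim=> [|e r IH] sr.
    by exists 0, 0; rewrite big_nil subst10 mul0r addr0.
  have [p [q E]] := IH (fun e' e'r => sr e' (mem_behead (s := e :: r) e'r)).
  have /deg1 := sr e (mem_head _ _).
  rewrite big_cons E -/(subst2 N (mpolyX C e)) subst2_X.
  have -> : lift ord0 ord0 = 1 :> 'I_2 by apply/val_inj.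
  case: (e (1%R : 'I_2)) => [|[|//]] _.
    exists (mcoeff e f *: 'X^(e ord0) + p), q.
    by rewrite subst1D subst1Z_Xn expr0 mulr1 addrA.
  exists p, (mcoeff e f *: 'X^(e ord0) + q).
  by rewrite subst1D subst1Z_Xn expr1 mulrDl -scalerAl addrCA.
by move=> /(_ (msupp f) (fun=> id)); rewrite /subst2 -comp_mpolyEX.
Qed.

(* Restriction of a polynomial in [z] to the line through the origin and [c]. *)
Local Notation on_line c := (mmap (@polyC C) (fun i : 'I_N => c i *: 'X)).

Lemma size_on_line c h : (size (on_line c h) <= msize h)%N.
Proof.
rewrite /mmap; apply: leq_trans (size_sum _ _ _) _.
apply/bigmax_leqP_seq => e eh _; rewrite mul_polyC.
apply: leq_trans (size_scale_leq _ _) _.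
have -> : mmap1 (fun i => c i *: 'X) e = (\prod_i c i ^+ e i) *: 'X^(mdeg e).
  rewrite mdegE -prodrXr -scaler_prod; apply: eq_bigr => i _.
  by rewrite exprZn.
apply: leq_trans (size_scale_leq _ _) _; rewrite size_polyXn.
exact: msize_mdeg_lt.
Qed.

Lemma on_line_sigma c k : on_line c (sig k) = (\sum_i c i ^+ k) *: 'X^k.
Proof.
rewrite /sigma rmorph_sum scaler_suml; apply: eq_bigr => i _ /=.
by rewrite rmorphXn/= mmapX mmap1U exprZn.
Qed.

(** The normalisation makes sigma_1 restrict to X, so restriction to the line undoes the
    substitution. *)
Lemma on_line_subst1 c g : \sum_i c i = 1 -> on_line c (subst1 N g) = g.
Proof.
move=> c1; rewrite /subst1 -horner_map/= on_line_sigma.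
under eq_bigr do rewrite expr1.
rewrite c1 scale1r -map_poly_comp.
have -> : map_poly (on_line c \o @mpolyC N C) g = map_poly (@polyC C) g.
  by apply: eq_map_poly => z /=; rewrite mmapC.
exact: comp_polyXr.
Qed.

Lemma size_subst1 (i0 : 'I_N) g : (size g <= msize (subst1 N g))%N.
Proof.
pose c (i : 'I_N) : C := (i0 == i)%:R.
rewrite -{1}(@on_line_subst1 c g) ?size_on_line//.
by under eq_bigr do rewrite -[c _]mulr1; rewrite (sum_delta (fun=> 1)).
Qed.

(* The lines through (1, 0, ...) and (2, -1, 0, ...) give the same value to
   [sigma 1] but not to [sigma 2], so no leading terms can cancel. *)
Lemma size_subst2 (i0 i1 : 'I_N) (p q : {poly C}) n : i0 != i1 ->
  (msize (subst1 N p + subst1 N q * sig 2) <= n)%N ->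
  (size p <= n)%N /\ (size (q * 'X^2)%R <= n)%N.
Proof.
move=> i01 sn.
have line c : \sum_i c i = 1 ->
    (size (p + (\sum_i c i ^+ 2) *: (q * 'X^2))%R <= n)%N.
  move=> c1; have := leq_trans (size_on_line c _) sn.
  by rewrite rmorphD rmorphM/= !on_line_subst1// on_line_sigma -scalerAr.
pose c1 (i : 'I_N) : C := (i0 == i)%:R.
pose c2 (i : 'I_N) : C := (i0 == i)%:R * 2 - (i1 == i)%:R * 1.
have l1 := line c1; have l2 := line c2.
have e1 k : \sum_i c1 i ^+ k.+1 = 1.
  rewrite (bigD1 i0)//= /c1 eqxx expr1n big1 ?addr0// => i.
  by rewrite eq_sym => /negPf->; rewrite expr0n.
have e2 k : \sum_i c2 i ^+ k.+1 = 2 ^+ k.+1 + (-1) ^+ k.+1.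
  rewrite (bigD1 i0)//= (bigD1 i1) 1?eq_sym//= /c2 !eqxx eq_sym (negPf i01).
  rewrite mul1r mul0r subr0 mul0r sub0r mul1r big1 ?addr0// => i /andP[].
  by rewrite eq_sym [i == i1]eq_sym => /negPf-> /negPf->; rewrite !mul0r subrr expr0n.
have s1 : \sum_i c1 i = 1 by rewrite -(e1 0%N); apply: eq_bigr => i _; rewrite expr1.
have s2 : \sum_i c2 i = 1.
  transitivity (\sum_i c2 i ^+ 1); first by apply: eq_bigr => i _; rewrite expr1.
  by rewrite e2 !expr1; ring.
move: {l1 l2} (l1 s1) (l2 s2); rewrite e1 e2 scale1r; set Q := q * 'X^2 => l1 l2.
have sQ : (size Q <= n)%N.
  (* On the two lines sigma_2 restricts to X^2 and 5 X^2, so the difference of the restrictions is 4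
     Q. *)
  have -> : Q = 4^-1 *: ((p + (2 ^+ 2 + (-1) ^+ 2) *: Q) - (p + Q)).
    have -> : (p + (2 ^+ 2 + (-1) ^+ 2) *: Q) - (p + Q) = (4 : C) *: Q.
      rewrite opprD addrACA subrr add0r -{2}[Q]scale1r -scalerBl.
      by congr (_ *: _); ring.
    by rewrite scalerA mulVf ?scale1r// pnatr_eq0.
  apply: leq_trans (size_scale_leq _ _) _; apply: leq_trans (size_polyD _ _) _.
  by rewrite size_polyN geq_max l1 l2.
split=> //; rewrite -(addrK Q p); apply: leq_trans (size_polyD _ _) _.
by rewrite size_polyN geq_max l1 sQ.
Qed.

Lemma msizeM_bound h h' k l : (msize h <= k.+1)%N -> (msize h' <= l.+1)%N ->
  (msize (h * h')%R <= (k + l).+1)%N.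
Proof.
have [->|h0] := eqVneq h 0; first by rewrite mul0r msize0.
have [->|h0'] := eqVneq h' 0; first by rewrite mulr0 msize0.
rewrite msizeM// => hk hl; rewrite -ltnS prednK; last first.
  by rewrite addn_gt0 lt0n msize_poly_eq0 h0.
by rewrite -addSn -addnS leq_add.
Qed.

Lemma msize_sigma k : (msize (sig k) <= k.+1)%N.
Proof.
rewrite /sigma; apply: leq_trans (mmeasure_sum _ _ _ _) _.
by apply/bigmax_leqP => i _; rewrite mpolyXn msizeX mdegMn mdeg1 mul1n.
Qed.

Lemma msize_sigmaX k j : (msize (sig k ^+ j)%R <= (k * j).+1)%N.
Proof.
elim: j => [|j IH]; first by rewrite expr0 msize1.
by rewrite exprS mulnS; apply: msizeM_bound => //; exact: msize_sigma.
Qed.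

Lemma at_squares_sigma k (x : 'rV[R]_N) :
  at_squares (sig k) x = (\sum_i x 0 i ^+ (2 * k))%:C.
Proof.
rewrite /at_squares /sigma rmorph_sum rmorph_sum; apply: eq_bigr => i _ /=.
by rewrite rmorphXn/= mevalXU -rmorphXn -exprM.
Qed.

Lemma at_squares_sigma1 (x : 'rV[R]_N) : at_squares (sig 1) x = (r2 x)%:C.
Proof. by rewrite at_squares_sigma. Qed.

Lemma at_squares_subst1 g (x : 'rV[R]_N) : at_squares (subst1 N g) x = g.[(r2 x)%:C].
Proof.
rewrite /at_squares /subst1 -horner_map/= -/(at_squares _ x) at_squares_sigma1.
rewrite -map_poly_comp; congr (_.[_]); apply: map_poly_id => z _ /=.
exact: mevalC.
Qed.

Lemma at_squaresM h h' (x : 'rV[R]_N) :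
  at_squares (h * h') x = at_squares h x * at_squares h' x.
Proof. exact: rmorphM. Qed.

Lemma at_squaresD h h' (x : 'rV[R]_N) :
  at_squares (h + h') x = at_squares h x + at_squares h' x.
Proof. exact: rmorphD. Qed.

Lemma at_squaresX h k (x : 'rV[R]_N) : at_squares (h ^+ k) x = at_squares h x ^+ k.
Proof. exact: rmorphXn. Qed.

End PowerSums.

(** * Equality of the span of the families with the polynomial space *)

Section SpanEquality.
Variables (R : realType) (N m : nat) (a b w : R).
Variables (i1 i2 : 'I_N) (v : Sigma R N m).
Hypotheses (i12 : i1 != i2) (w0 : w != 0) (Nalpha : N%:R * (alpha N a b + 1) != 0 :> R).
Local Notation C := R[i].
Local Notation W := (wave R N m).
Local Notation conf := (@config R N).
Local Notation sig k := (sigma R N k).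
Local Notation Phi := (Phi i1 v).
Local Notation s1 x := ((r2 x)%:C : C).
Local Notation s2 x := ((\sum_i x 0 i ^+ 4)%:C : C).
Local Notation fam := (eigenfamily i1 v a b w).
Local Notation muWm := (@muW R N m a b w).

Lemma scale_swap (c d : C) (u : Sigma R N m) : c *: (d *: u) = d *: (c *: u).
Proof. by rewrite !scalerA mulrC. Qed.

(** These identities expand the null states of degree 1 and 2; the versions ending in K solve for
    Phi^(1) and sigma_2 Phi^(0), dividing by N and N (alpha + 1). *)
Lemma scaler_chi1 (n c d : C) (u u' : Sigma R N m) :
  n *: (c *: u) + -1 *: ((c * d) *: u') = c *: (n *: u - d *: u').
Proof. by rewrite scaleN1r scalerBr !scalerA [n * c]mulrC. Qed.

Lemma scaler_chi1K (n c d : C) (u u' : Sigma R N m) : n != 0 ->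
  n^-1 *: (c *: (n *: u - d *: u') + (c * d) *: u') = c *: u.
Proof.
move=> n0; rewrite scalerBr [c *: (d *: u')]scalerA subrK !scalerA.
by rewrite [n^-1 * c]mulrC divfK.
Qed.

Lemma scaler_chi2 (k l c d s : C) (u : Sigma R N m) :
  k *: (c *: (s *: u)) - l *: ((c * d) *: u) = c *: ((k * s - l * d) *: u).
Proof. by rewrite !scalerA -scalerBl; congr (_ *: _); ring. Qed.

Lemma scaler_chi2K (k l c d s : C) (u : Sigma R N m) : k != 0 ->
  k^-1 *: (c *: ((k * s - l * d) *: u) + l *: ((c * d) *: u)) = c *: (s *: u).
Proof. by move=> k0; rewrite !scalerA -scalerDl scalerA; congr (_ *: _); field. Qed.

Lemma scaler_affine (c d s : C) (u : Sigma R N m) : c *: u + d *: (s *: u) = (c + d * s) *: u.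
Proof. by rewrite scalerA -scalerDl. Qed.

Definition chi2 (x : 'rV[R]_N) : R :=
  N%:R * (alpha N a b + 1) * (\sum_i x 0 i ^+ 4) - beta N a b * r2 x ^+ 2.

Lemma chi2C (x : 'rV[R]_N) : (chi2 x)%:C =
  (N%:R * (alpha N a b + 1))%:C * s2 x - (beta N a b)%:C * s1 x ^+ 2 :> C.
Proof. by rewrite rmorphB !rmorphM. Qed.

Lemma lin_muH n : lin_set (muHspace i1 v a b w n).
Proof.
have linH : lin_set (Hspace i1 v n) := lin_cspan _.
split=> [F F' FF' [G HG FG]||F F' [G HG FG] [G' HG' FG']|c F [G HG FG]].
- by exists G => // x cx; rewrite -FF'// FG.
- by exists (fun=> 0); [exact: lin0|move=> x _; rewrite /muW scaler0].
- exists (fun x => G x + G' x); first exact: linD.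
  by move=> x cx; rewrite (FG x cx) (FG' x cx) /muW scalerDr.
- exists (fun x => c *: G x); first exact: linZ.
  by move=> x cx; rewrite (FG x cx); exact: scale_swap.
Qed.

Lemma Hspace_Phi0 n (g : {poly C}) : (size g <= n.+1)%N ->
  Hspace i1 v n (fun x => g.[s1 x] *: Phi 0 x).
Proof.
apply: (lin_horner (t := fun x => s1 x)) => [|j jn]; first exact: lin_cspan.
pose e : multinom 2 := mnm_muln (mnm1 ord0) j.
apply: sub_cspan; left; exists (mpolyX C e).
have e0 : e ord0 = j by rewrite mulmnE mnm1E eqxx mul1n.
have e1 (i : 'I_2) : i != ord0 -> e i = 0%N.
  by move=> i0; rewrite mulmnE mnm1E eq_sym (negPf i0) mul0n.
split; first by rewrite mderivX e1// scale0r mderiv0.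
  rewrite subst2_X e0 e1// expr0 mulr1; apply: leq_trans (msize_sigmaX _ _ _ _) _.
  by rewrite mul1n.
apply/funext => x; rewrite subst2_X e0 e1// expr0 mulr1.
by rewrite at_squaresX at_squares_sigma1.
Qed.

(** As sigma_2 has degree 2 in z, the degree of g is at most n - 2; for n < 2 the truncated bound
    forces g = 0. *)
Lemma Hspace_sigma2_Phi0 n (g : {poly C}) : (size g <= n.-1)%N ->
  Hspace i1 v n (fun x => g.[s1 x] *: (s2 x *: Phi 0 x)).
Proof.
apply: (lin_horner (t := fun x => s1 x)) => [|j jn]; first exact: lin_cspan.
apply: sub_cspan; left.
exists (mpolyX C (mnm_add (mnm_muln (mnm1 ord0) j) (mnm1 (1%R : 'I_2)))).
set e := mnm_add _ _.
have e0 : e ord0 = j by rewrite mnmDE mulmnE !mnm1E eqxx mul1n addn0.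
have e1 : e (1%R : 'I_2) = 1%N by rewrite mnmDE mulmnE !mnm1E eqxx.
have e1' : e (lift ord0 ord0) = 1%N.
  by rewrite -[RHS]e1; congr (fun_of_multinom e _); exact/val_inj.
split.
- rewrite mderivX e1 scale1r mderivX; set k := (_ (1%R : 'I_2)).
  have -> : k = 0%N by rewrite /k mnmBE e1 mnm1E eqxx.
  by rewrite scale0r.
- rewrite subst2_X e0 e1' expr1.
  apply: leq_trans (msizeM_bound (msize_sigmaX _ _ _ _) (msize_sigma _ _ _)) _.
  by rewrite mul1n addn2 ltnS; case: n jn => [|n] //=; rewrite ltnS.
- apply/funext => x; rewrite subst2_X e0 e1' expr1 at_squaresM at_squaresX.
  by rewrite at_squares_sigma1 at_squares_sigma scalerA.
Qed.

Lemma Hspace_Phi1 n (g : {poly C}) : (size g <= n)%N ->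
  Hspace i1 v n (fun x => g.[s1 x] *: Phi 1 x).
Proof.
apply: (lin_horner (t := fun x => s1 x)) => [|j jn]; first exact: lin_cspan.
apply: sub_cspan; right; exists 'X^j; split.
  rewrite -['X^j]scale1r subst1Z_Xn scale1r.
  by apply: leq_trans (msize_sigmaX _ _ _ _) _; rewrite mul1n.
by apply/funext => x; rewrite at_squares_subst1 hornerXn.
Qed.

(** A null state of degree d is multiplied by a Laguerre polynomial of degree k - d, so the total
    degree in z is at most k <= n. *)
Lemma fam_sub_muH n : fam n `<=` muHspace i1 v a b w n.
Proof.
have linH : lin_set (Hspace i1 v n) := lin_cspan _.
have sL nu k : (size (lagC nu w k) <= k.+1)%N by exact: size_poly.
move=> F [k kn [->|[k1 ->]|[k2 ->]]].
- exists (fun x => (laguerre (alpha N a b - 1) k (w * r2 x))%:C *: Phi 0 x) => //.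
  apply: lin_ext linH _ _ _ (Hspace_Phi0 (leq_trans (sL _ k) _)) => [x _|]; last exact: kn.
  by rewrite -lagCE.
- eexists; last by move=> x _; reflexivity.
  set L := lagC (alpha N a b + 1) w (k - 1).
  have sLn : (size L <= n)%N by apply: leq_trans (sL _ _) _; rewrite subn1 prednK.
  have sXL : (size (L * 'X)%R <= n.+1)%N.
    by apply: leq_trans (size_polyMleq _ _) _; rewrite size_polyX addn2.
  apply: lin_ext linH _ _ _ (linD linH (linZ linH N%:R (Hspace_Phi1 sLn))
    (linZ linH (-1) (Hspace_Phi0 sXL))) => x _.
  by rewrite lagCE hornerMX; exact: scaler_chi1.
- eexists; last by move=> x _; reflexivity.
  set L := lagC (alpha N a b + 3) w (k - 2).
  have sLn : (size L <= n.-1)%N.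
    apply: leq_trans (sL _ _) _; rewrite subn2 prednK; last by case: (k) k2 => [|[]].
    by rewrite -!subn1 leq_sub2r.
  have sXL : (size (L * 'X^2)%R <= n.+1)%N.
    apply: leq_trans (size_polyMleq _ _) _; rewrite size_polyXn addn3/=.
    by rewrite ltnS -(prednK (ltnW (leq_trans k2 kn))) ltnS.
  apply: lin_ext linH _ _ _ (linD linH
    (linZ linH (N%:R * (alpha N a b + 1))%:C (Hspace_sigma2_Phi0 sLn))
    (linZ linH (-1) (linZ linH (beta N a b)%:C (Hspace_Phi0 sXL)))) => x _.
  by rewrite lagCE -/(chi2 x) chi2C hornerM hornerXn scaleN1r; exact: scaler_chi2.
Qed.

Lemma lin_muW n : lin_set [set F | cspan (fam n) (muWm F)].
Proof.
have linG := lin_cspan (fam n).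
split=> [F F' FF' /= VF||F F' /= VF VF'|c F /= VF].
- by apply: lin_ext linG _ _ _ VF => x cx; rewrite /muW FF'.
- by apply: lin_ext linG _ _ _ (lin0 linG) => x _; rewrite /muW scaler0.
- by apply: lin_ext linG _ _ _ (linD linG VF VF') => x _; rewrite /muW scalerDr.
- by apply: lin_ext linG _ _ _ (linZ linG c VF) => x _; exact: scale_swap.
Qed.

Lemma fam_Phi0 n (g : {poly C}) : (size g <= n.+1)%N ->
  cspan (fam n) (muWm (fun x => g.[s1 x] *: Phi 0 x)).
Proof.
apply: (lin_laguerre (nu := alpha N a b - 1) (lin_muW n) w0) => j jn.
by apply: sub_cspan; exists j => //; exact: Or31.
Qed.

(** The correction g(sigma_1) sigma_1 Phi^(0) has degree at most n and is already in the span, so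
    adding it back isolates Phi^(1). *)
Lemma fam_Phi1 n (g : {poly C}) : (size g <= n)%N ->
  cspan (fam n) (muWm (fun x => g.[s1 x] *: Phi 1 x)).
Proof.
move=> gn; have linG := lin_muW n.
have V1 : cspan (fam n) (muWm (fun x =>
    g.[s1 x] *: ((N%:R : C) *: Phi 1 x - s1 x *: Phi 0 x))).
  apply: (lin_laguerre (nu := alpha N a b + 1) linG w0) gn => j jn.
  by apply: sub_cspan; exists j.+1 => //; apply: Or32; rewrite /Psi1 subn1.
have V0 : cspan (fam n) (muWm (fun x => (g * 'X).[s1 x] *: Phi 0 x)).
  apply: fam_Phi0; apply: leq_trans (size_polyMleq _ _) _.
  by rewrite size_polyX addn2.
have N0 : (N%:R : C) != 0 by rewrite pnatr_eq0 -lt0n; case: (N) i1 => [[]|].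
apply: lin_ext linG _ _ _ (linZ linG N%:R^-1 (linD linG V1 V0)) => x _.
by rewrite hornerMX; exact: scaler_chi1K.
Qed.

Lemma fam_sigma2_Phi0 n (g : {poly C}) : (size g <= n.-1)%N ->
  cspan (fam n) (muWm (fun x => g.[s1 x] *: (s2 x *: Phi 0 x))).
Proof.
move=> gn; have linG := lin_muW n.
pose Y : W := fun x => (chi2 x)%:C *: Phi 0 x.
have V2 : [set F | cspan (fam n) (muWm F)] (fun x => g.[s1 x] *: Y x).
  refine (lin_laguerre (nu := alpha N a b + 3) (Y := Y) linG w0 _ gn) => j jn.
  (* The function of index k = j + 2 carries the Laguerre polynomial of degree j, and k <= n is the
     bound j < n - 1. *)
  apply: sub_cspan; exists j.+2; first by case: (n) jn.
  by apply: Or33; rewrite /Psi2 subn2.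
have V0 : [set F | cspan (fam n) (muWm F)] (fun x => (g * 'X^2).[s1 x] *: Phi 0 x).
  apply: fam_Phi0; have [->|g0] := eqVneq g 0; first by rewrite mul0r size_poly0.
  apply: leq_trans (size_polyMleq _ _) _; rewrite size_polyXn addn3/=.
  by move: g0 gn; rewrite -size_poly_gt0; case: (n) => [|n']; [case: size|].
have A0 : (N%:R * (alpha N a b + 1))%:C != 0 :> C.
  by rewrite (inj_eq (@complexI _) _ 0).
apply: lin_ext linG _ _ _ (linZ linG (N%:R * (alpha N a b + 1))%:C^-1
  (linD linG V2 (linZ linG (beta N a b)%:C V0))) => x _.
by rewrite /Y chi2C hornerM hornerXn; exact: scaler_chi2K.
Qed.

Lemma muH_sub_fam n : muHspace i1 v a b w n `<=` cspan (fam n).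
Proof.
move=> F [G HG FG]; have linG := lin_muW n.
suff /(_ G HG) VG : Hspace i1 v n `<=` [set F | cspan (fam n) (muWm F)].
  by apply: lin_ext (lin_cspan _) _ _ _ VG => x cx; rewrite FG.
apply: (cspan_min linG) => _ [[f [f2 sf ->]]|[g [sg ->]]].
  have [p [q E]] := subst2_affine N f2; rewrite E in sf *.
  have [sp sq] := size_subst2 i12 sf.
  have sq' : (size q <= n.-1)%N.
    have [->|q0] := eqVneq q 0; first by rewrite size_poly0.
    by move: sq; rewrite size_mulXn// ltnS; case: (n).
  apply: lin_ext linG _ _ _ (linD linG (fam_Phi0 sp) (fam_sigma2_Phi0 sq')) => x _.
  by rewrite at_squaresD at_squaresM !at_squares_subst1 at_squares_sigma; exact: scaler_affine.
have sg' : (size g <= n)%N := leq_trans (size_subst1 i1 g) sg.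
by apply: lin_ext linG _ _ _ (fam_Phi1 sg') => x _; rewrite at_squares_subst1.
Qed.

Lemma span_fam n : cspan (fam n) = muHspace i1 v a b w n.
Proof.
apply/seteqP; split; last exact: muH_sub_fam.
exact: (cspan_min (lin_muH n)) (@fam_sub_muH n).
Qed.

End SpanEquality.

Theorem theorem3 (R : realType) (N m : nat) (hN : (2 < N)%N) (a b w : R)
    (ha : 1 / 2 < a) (hb : 1 / 2 < b) (hw : 0 < w) :
  (forall (s : Sigma R N m) (k : nat),
     eigenfunction (H1 a b w) (energy N a b w k)
       (Psi0 (site1 hN) s a b w k)) /\
  (forall (s : Sigma R N m) (k : nat), (1 <= k)%N ->
     eigenfunction (H1 a b w) (energy N a b w k)
       (Psi1 (site1 hN) s a b w k)) /\
  (forall (s : Sigma R N m) (k : nat), (2 <= k)%N ->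
     eigenfunction (H1 a b w) (energy N a b w k)
       (Psi2 (site1 hN) s a b w k)) /\
  (forall (s : Sigma R N m) (n : nat),
     invariant_under (H1 a b w) (muHspace (site1 hN) s a b w n) /\
     cspan (eigenfamily (site1 hN) s a b w n) =
       muHspace (site1 hN) s a b w n).
Proof.
have hN1 : (1 < N)%N by exact: ltnW.
have E0k s k := Psi0_eigen hN1 a b w (site1 hN) s k.
have E1k s k := @Psi1_eigen R N m hN1 a b w (site1 hN) s k.
have E2k s k := @Psi2_eigen R N m hN1 a b w (site1 hN) s k.
split; [exact: E0k|split; [exact: E1k|split; [exact: E2k|move=> s n]]].
(* A second site makes sigma_2 and sigma_1^2 independent. *)
have i12 : site1 hN != Ordinal hN1 by [].
have w0 : w != 0 by rewrite gt_eqF.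
have N0 : 0 < N%:R :> R by rewrite ltr0n ltnW.
(* Positivity of alpha allows sigma_2 Phi^(0) to be recovered from the degree 2 null state. *)
have alpha0 : 0 < alpha N a b by rewrite /alpha mulr_gt0//; lra.
have Nalpha : N%:R * (alpha N a b + 1) != 0 by rewrite gt_eqF// mulr_gt0// ltr_wpDr.
have span := span_fam s i12 w0 Nalpha n.
split=> //; rewrite -span; apply: invariant_cspan => F [k _ FE].
exists (energy N a b w k).
by case: FE => [->|[k1 ->]|[k2 ->]]; [exact: E0k|exact: E1k|exact: E2k].
Qed.
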